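(* Let $0<\alpha<n$, $\gamma\ge 0$, $1\le p_1<\frac{n}{\alpha}$, and let $\phi:\mathbb{R}^+\to\mathbb{R}^+$ be of class $\mathcal{G}_{p_1}$. Let $s,t$ be such that one of the following holds: (a) $1\le p_1<t$ and $1<s<t=\frac{n}{n-\alpha}$ (allowed for every $\gamma\ge 0$); or (b) $\gamma>0$, $1\le p_1\le t$, $1<s\le t$ and $\frac{n}{n+\gamma-\alpha}<t<\frac{n}{n-\alpha}$. Suppose that $\phi(r)r^n$ is almost increasing and that there are constants $C_1,C_2,C_3>0$ such that for every $R>0$: (i) $\int_R^\infty\phi(r)\,r^{\frac{n}{t'}-1}\,dr\le C_1\,\phi(R)\,R^{\frac{n}{t'}}$; (ii) $\int_0^R\phi^{p_1}(r)\,r^{n-1}\,dr\le C_2\,\phi^{p_1}(R)\,R^n$; (iii) $\int_0^R\frac{r^{n-1}}{\phi^{s'}(r)\,r^{ns'}}\,dr\le\frac{C_3\,R^n}{\phi^{s'}(R)\,R^{ns'}}$. Define $p_2$ by $\frac1{p_2}=\frac1{p_1}-\frac1{s'}$ and put $\psi(r):=\phi(r)\,r^{\frac{n}{t'}}$. Then there are constants $C_4,C_5>0$, depending on $\phi,n,p_1,s,t$ but not on $\alpha$ and $\gamma$, such that $$C_4\,\|K_{\alpha,\gamma}\|_{L^{p_1,t}}\le\|I_{\alpha,\gamma}\|_{L^{p_1,\phi}\to L^{p_2,\psi}}\le C_5\,\|K_{\alpha,\gamma}\|_{L^{s,t}}.$$ In particular, for $\gamma=0$, $1\le p_1<t$ and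 $1<s<t=\frac{n}{n-\alpha}$, $$C_4\,\|K_{\alpha}\|_{L^{p_1,t}}\le\|I_{\alpha}\|_{L^{p_1,\phi}\to L^{p_2,\psi}}\le C_5\,\|K_{\alpha}\|_{L^{s,t}}.$$
   Context: Bessel-Riesz kernel and operator: for $0<\alpha<n$ and $\gamma\ge 0$, $K_{\alpha,\gamma}(x):=\frac{|x|^{\alpha-n}}{(1+|x|)^{\gamma}}$ on $\mathbb{R}^n$, and $I_{\alpha,\gamma}f(x):=\int_{\mathbb{R}^n}K_{\alpha,\gamma}(x-y)f(y)\,dy$. For $\gamma=0$ write $K_\alpha:=K_{\alpha,0}$, i.e. $K_\alpha(x)=|x|^{\alpha-n}$, and $I_\alpha:=I_{\alpha,0}$ (the fractional integral operator). A function $g:\mathbb{R}^+\to\mathbb{R}^+$ is almost decreasing if there is $C>0$ with $g(r)\ge C g(s)$ whenever $r\le s$, and almost increasing if there is $C>0$ with $g(r)\le C g(s)$ whenever $r\le s$. Class $\mathcal{G}_p$ ($1\le p<\infty$): $\phi:\mathbb{R}^+\to\mathbb{R}^+$ is of class $\mathcal{G}_p$ if $\phi$ is almost decreasing and $\phi^p(r)r^n$ is almost increasing. Generalized Morrey space: for $1\le p<\infty$ and $\phi:\mathbb{R}^+\to\mathbb{R}^+$, $L^{p,\phi}(\mathbb{R}^n)$ is the set of all $f\in L^p_{\rm loc}(\mathbb{R}^n)$ with $$\|f\|_{L^{p,\phi}}:=\sup_{B=B(a,r)}\frac{1}{\phi(r)}\left(\frac{1}{|B|}\int_B|f(x)|^p\,dx\right)^{1/p}<\infty,$$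 the supremum being over all balls $B(a,r)$, $a\in\mathbb{R}^n$, $r>0$, where $|B|$ is the Lebesgue measure of $B$. Classical Morrey space: for $1\le p\le q<\infty$, $L^{p,q}(\mathbb{R}^n)$ is the set of $f\in L^p_{\rm loc}(\mathbb{R}^n)$ with $$\|f\|_{L^{p,q}}:=\sup_{B=B(a,r)}|B|^{\frac1q-\frac1p}\left(\int_B|f(x)|^p\,dx\right)^{1/p}<\infty.$$ Operator norm: for a linear operator $T$ from a normed space $X$ to a normed space $Y$, $\|T\|_{X\to Y}:=\sup_{f\ne 0}\frac{\|Tf\|_Y}{\|f\|_X}$. For $1\le u<\infty$, $u'$ denotes the dual exponent, $\frac1u+\frac1{u'}=1$. *)

(* Defs.v *)
From HB Require Import structures.
From mathcomp Require Import all_boot all_order all_algebra.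
From mathcomp Require Import all_classical all_reals all_analysis.
From mathcomp Require Import measurable_realfun.

Set Implicit Arguments.
Unset Strict Implicit.
Unset Printing Implicit Defensive.

Import Order.TTheory GRing.Theory Num.Theory.

Local Open Scope classical_set_scope.
Local Open Scope ring_scope.

(* R^n is the library's measurable type of n-tuples, with the product Borel
   sigma-algebra. *)
Notation Rn R n := (n.-tuple (measurableTypeR R)).

Section euclidean.
Context {R : realType} {n : nat}.
Implicit Types x y a : Rn R n.

Definition tsub x y : Rn R n := [tuple (tnth x i - tnth y i : R) | i < n].

Definition enorm x : R := Num.sqrt (\sum_(i < n) (tnth x i : R) ^+ 2).

Definition eball a (r : R) : set (Rn R n) := [set x | enorm (tsub x a) < r].

End euclidean.

(* Lebesgue measure on R^n: the n-fold product of [lebesgue_measure], computed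
   by slicing along the first coordinate. *)
Fixpoint lebesgue_n {R : realType} (n : nat) : set (Rn R n) -> \bar R :=
  match n with
  | 0%N => fun A => \d_[tuple] A
  | m.+1 => fun A => (\int[@lebesgue_measure R]_x
              lebesgue_n [set y : Rn R m | A [tuple of x :: y]])%E
  end.

Arguments lebesgue_n {R} n.

Section lebesgue_n_measure.
Context {R : realType}.

Let consp n (p : measurableTypeR R * Rn R n) : Rn R n.+1 :=
  [tuple of p.1 :: p.2].

Let mconsp n : measurable_fun setT (@consp n).
Proof. exact: measurable_cons. Qed.

Let unconsp n (x : Rn R n.+1) : measurableTypeR R * Rn R n :=
  (thead x, [tuple of behead x]).

Let consK n : cancel (@consp n) (@unconsp n).
Proof.
by move=> [x y]; rewrite /consp /unconsp theadE; congr (_, _); exact/val_inj.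
Qed.

Let munconsp n : measurable_fun setT (@unconsp n).
Proof.
apply/measurable_fun_pairP; split => /=.
  exact: measurable_tnth.
exact: measurable_behead.
Qed.


Local Notation mu := (@lebesgue_measure R).

Let lebesgue_nS n :
  lebesgue_n n.+1 = pushforward (mu \x @lebesgue_n R n)%E (@consp n).
Proof.
apply/funext => A; rewrite /pushforward /product_measure1.
apply: eq_integral => x _ /=; congr lebesgue_n.
by apply/seteqP; split => y; rewrite /xsection /= inE.
Qed.

Let lebesgue_n_measure n :
  exists m : {sigma_finite_measure set (Rn R n) -> \bar R}, lebesgue_n n = m.
Proof.
elim: n => [|n [m mE]].
  by exists (\d_([tuple] : Rn R 0)).
rewrite lebesgue_nS mE.
pose p : {measure set (Rn R n.+1) -> \bar R} :=
  @measure_function_pushforward__canonical__measure_function_Measure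
    _ _ _ _ _ (mu \x m)%E _ (@mconsp n).
have sp : sigma_finite setT p.
  have /sigma_finiteP[F [TF ndF Foo]] := sigma_finiteT mu.
  have /sigma_finiteP[G [TG ndG Goo]] := sigma_finiteT m.
  exists (fun k => @unconsp n @^-1` (F k `*` G k)).
    rewrite -preimage_bigcup (_ : \bigcup_k _ = setT) ?preimage_setT//.
    rewrite -setXTT TF TG; apply/seteqP; split => -[x y].
      by move=> [k _ []/= ? ?]; split; exists k.
    move=> [/= [k _ Fkx] [l _ Gly]]; exists (maxn k l) => //; split.
      by move: x Fkx; exact/subsetPset/ndF/leq_maxl.
    by move: y Gly; exact/subsetPset/ndG/leq_maxr.
  move=> k; have [mF ?] := Foo k; have [mG ?] := Goo k.
  split.
    by rewrite -[X in measurable X]setTI; apply: munconsp => //;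
      exact: measurableX.
  rewrite /p /= /pushforward -comp_preimage (_ : _ \o _ = id).
    by rewrite preimage_id product_measure1E// lte_mul_pinfty// ge0_fin_numE.
  by apply/funext => x /=; exact: consK.
pose isp := Measure_isSigmaFinite.Build _ _ _ p sp.
pose p' : {sigma_finite_measure set (Rn R n.+1) -> \bar R} :=
  HB.pack (p : set _ -> \bar R) (Measure.class p) isp.
by exists p'.
Qed.

Let lebesgue_n0 n : @lebesgue_n R n set0 = 0%E.
Proof. by have [m ->] := lebesgue_n_measure n; exact: measure0. Qed.

Let lebesgue_n_ge0 n A : (0 <= @lebesgue_n R n A)%E.
Proof. by have [m ->] := lebesgue_n_measure n; exact: measure_ge0. Qed.

Let lebesgue_n_sigma_additive n : semi_sigma_additive (@lebesgue_n R n).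
Proof.
by have [m ->] := lebesgue_n_measure n; exact: measure_semi_sigma_additive.
Qed.

HB.instance Definition _ n := isMeasure.Build _ _ _ (@lebesgue_n R n)
  (@lebesgue_n0 n) (@lebesgue_n_ge0 n) (@lebesgue_n_sigma_additive n).

Let lebesgue_n_sigma_finite n : sigma_finite setT (@lebesgue_n R n).
Proof. by have [m ->] := lebesgue_n_measure n; exact: sigma_finiteT. Qed.

HB.instance Definition _ n := Measure_isSigmaFinite.Build _ _ _
  (@lebesgue_n R n) (@lebesgue_n_sigma_finite n).

End lebesgue_n_measure.

Lemma lebesgue_n_box {R : realType} n (A : 'I_n -> set (measurableTypeR R)) :
  (forall i, measurable (A i)) ->
  lebesgue_n n [set x : Rn R n | forall i, A i (tnth x i)] =
  (\prod_(i < n) lebesgue_measure (A i))%E.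
Proof.
elim: n A => [|n ih] A mA.
  by rewrite big_ord0 /= diracE mem_set// => -[].
rewrite big_ord_recl /= -ih; last by move=> i; exact: mA.
set B := [set y : Rn R n | _].
under eq_integral => x _.
  rewrite (_ : lebesgue_n n _ = (\1_(A ord0) x)%:E * lebesgue_n n B)%E; first over.
  rewrite indicE; have [xA|xA] := boolP (x \in A ord0).
    rewrite mul1e; congr lebesgue_n; apply/seteqP; split => y /= Ay.
      by move=> i; have := Ay (lift ord0 i); rewrite tnthS.
    move=> i; case: (unliftP ord0 i) => [j|] ->; first by rewrite tnthS; exact: Ay.
    by rewrite tnth0; exact: set_mem.
  rewrite mul0e (_ : [set _ | _] = set0) ?measure0//.
  apply/seteqP; split => y //= /(_ ord0); rewrite tnth0.
  by move=> A0x; move: xA; rewrite mem_set.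
have mB : measurable B.
  rewrite (_ : B = \bigcap_(i in [set: 'I_n])
      ((fun y : Rn R n => tnth y i) @^-1` A (lift ord0 i))); last first.
    by apply/seteqP; split => y By i; [move=> _; exact: By|exact: By].
  apply: fin_bigcap_measurable => // i _; rewrite -[X in measurable X]setTI.
  exact: measurable_tnth.
rewrite ge0_integralZr//; first by rewrite integral_indic ?setIT.
by apply/measurable_EFinP; exact: measurable_indic.
Qed.

Section growth_classes.
Context {R : realType}.
Implicit Types h phi : R -> R.

(* Functions R^+ -> R^+ are represented by functions R -> R of which only the
   values at positive arguments matter. *)
Definition pos_fun h := forall r : R, 0 < r -> 0 < h r.

Definition almost_decreasing h :=
  exists2 C : R, 0 < C & forall r s : R, 0 < r -> r <= s -> C * h s <= h r.

Definition almost_increasing h :=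
  exists2 C : R, 0 < C & forall r s : R, 0 < r -> r <= s -> h r <= C * h s.

Definition class_G (n : nat) (p : R) phi :=
  [/\ pos_fun phi, almost_decreasing phi &
      almost_increasing (fun r => phi r `^ p * r ^+ n)].

End growth_classes.

Section morrey.
Context {R : realType} {n : nat}.
Implicit Types (f : Rn R n -> R) (g : Rn R n -> \bar R) (p q : R).

(* Every compact set lies in a ball and every ball in a compact set. *)
Definition Lp_loc p f :=
  measurable_fun setT f /\
  forall (a : Rn R n) (r : R), 0 < r ->
    (\int[lebesgue_n n]_(x in eball a r) (`|f x| `^ p)%:E < +oo)%E.

(* The Morrey norms are stated for extended-real-valued functions, so that they
   apply to an integral operator before its integrals are known to converge: a
   diverging integral has value +oo or -oo (the latter also for oo - oo). *)
Definition gmorrey_norm p (phi : R -> R) g : \bar R :=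
  ereal_sup [set z | exists a r, 0 < r /\
    z = ((phi r)^-1%:E *
         ((lebesgue_n n (eball a r))^-1 *
          \int[lebesgue_n n]_(x in eball a r) (`|g x| `^ p)) `^ p^-1)%E].

Definition gmorrey p (phi : R -> R) : set (Rn R n -> R) :=
  [set f | Lp_loc p f /\ (gmorrey_norm p phi (EFin \o f) < +oo)%E].

Definition morrey_norm p q g : \bar R :=
  ereal_sup [set z | exists a r, 0 < r /\
    z = (lebesgue_n n (eball a r) `^ (q^-1 - p^-1) *
         (\int[lebesgue_n n]_(x in eball a r) (`|g x| `^ p)) `^ p^-1)%E].

(* Elements of function spaces are identified when they agree almost everywhere:
   the supremum is over the f in X that are not almost everywhere zero. *)
Definition op_norm (X : set (Rn R n -> R))
    (normX normY : (Rn R n -> \bar R) -> \bar R)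
    (T : (Rn R n -> R) -> Rn R n -> \bar R) : \bar R :=
  ereal_sup [set z | exists2 f,
    X f /\ ~ {ae lebesgue_n n, forall x, f x = 0} &
    z = (normY (T f) / normX (EFin \o f))%E].

End morrey.

Section bessel_riesz.
Context {R : realType} {n : nat}.
Implicit Types (alpha gamma : R) (x : Rn R n) (f : Rn R n -> R).

(* The value at the origin is 0 by the convention on [powR]; it is irrelevant
   to integrals. *)
Definition bessel_riesz_kernel alpha gamma x : R :=
  enorm x `^ (alpha - n%:R) / (1 + enorm x) `^ gamma.

Definition bessel_riesz alpha gamma f x : \bar R :=
  (\int[lebesgue_n n]_y (bessel_riesz_kernel alpha gamma (tsub x y) * f y)%:E)%E.

Definition riesz_kernel alpha := bessel_riesz_kernel alpha 0.

Definition riesz alpha := bessel_riesz alpha 0.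

End bessel_riesz.

(* Main.v *)
Require Import Defs.
From mathcomp Require Import all_boot all_order all_algebra.
From mathcomp Require Import all_classical all_reals all_analysis.
From mathcomp Require Import measurable_realfun.
From mathcomp Require Import ring lra.

(* Upper bound: for x in B(a, rho) split the integral at |x - y| = rho. The near
   part is the convolution of K 1_B(0, rho) with |f| 1_B(a, 2 rho), and Young's
   inequality with 1 + 1/p2 = 1/s + 1/p1 applies. For the far part, radial
   monotonicity of K gives K(z) <= C ||K||_(s,t) |z|^(-n/t); writing this power
   as an integral over r > |z|, Tonelli and the bound
   \int_B(x, r) |f| <= C ||f|| phi(r) r^n lead to the integral in (i).

   Lower bound: test on f0 = phi(|x|), in L^(p1,phi) by (ii). On the ball
   with diameter [0, x] both |y| and |x - y| are at most |x|, so that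
   I f0 (x) >= C K(x) phi(|x|) |x|^n with C independent of alpha and gamma.
   Hoelder's inequality with 1/p1 = 1/p2 + 1/s', whose second factor is
   controlled by (iii), recovers the L^p1 means of K.

   Condition (i) and the growth of phi^p1 r^n force 1/p1 > 1/t', so p2 > 0. *)

Set Implicit Arguments.
Unset Strict Implicit.
Unset Printing Implicit Defensive.

Import Order.TTheory GRing.Theory Num.Theory.

Local Open Scope classical_set_scope.
Local Open Scope ring_scope.

(** The obstacle is that [phi] is not assumed measurable. Integrals of nonnegative functions are
    monotone all the same, but Tonelli's theorem and Hoelder's inequality need measurable
    integrands. So [phi] is replaced by a measurable nonincreasing [g] with [c * phi <= g <= phi],
    and [1/(phi r^n)], almost decreasing because [phi r^n] is almost increasing, by a similar [w].
    In particular the test function of the lower bound is really [g(|x|)]. The splitting radius is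
    that of the ball on which the image is measured, so that near and far part both scale like
    [phi(rho) rho^(n/t') = psi(rho)]. The constants do not see [alpha] and [gamma] because the
    kernel enters only through its sign, its measurability, its radial monotonicity and its Morrey
    norms. Monotonicity fails at the origin, where [powR] gives the kernel the value 0; the origin
    is therefore removed as a null set or treated apart. *)

Local Ltac nonneg := repeat first
  [exact: powR_ge0 | assumption | exact: ltW | exact: ler0n
  | apply: exprn_ge0 | apply: mulr_ge0 | apply: addr_ge0].

(** * Monotonicity of the integral and Hoelder's inequality *)

Section le_integral.
Import HBNNSimple.

(** No measurability is assumed: the integral is a supremum over nonnegative simple functions below
    the integrand, and a larger integrand admits more of them. *)
Lemma le_integral_nonneg d (T : measurableType d) (R : realType)
    (mu : {measure set T -> \bar R}) (D : set T) (f g : T -> \bar R) :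
  (forall x, D x -> 0 <= f x)%E -> (forall x, D x -> f x <= g x)%E ->
  (\int[mu]_(x in D) f x <= \int[mu]_(x in D) g x)%E.
Proof.
move=> f0 fg.
have g0 x : D x -> (0 <= g x)%E by move=> Dx;
  exact: le_trans (f0 x Dx) (fg x Dx).
rewrite !ge0_integralE//; apply: ge_ereal_sup => _ [h hf <-].
apply: ereal_sup_ubound; exists h => // x.
apply: le_trans (hf x) _; rewrite /patch; case: ifPn => // /set_mem; exact: fg.
Qed.

End le_integral.

Section hoelder_weights.
Context d (T : measurableType d) (R : realType).
Variable mu : {measure set T -> \bar R}.
Implicit Types F G H : T -> R.

(** Weights replace conjugate exponents so that the endpoints, where one exponent is infinite, are
    included; they occur when [p1 = 1]. *)
Lemma integral_powR_mul F G (a : R) :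
  measurable_fun setT F -> measurable_fun setT G ->
  (forall x, 0 <= F x) -> (forall x, 0 <= G x) -> 0 <= a <= 1 ->
  (\int[mu]_x (F x `^ a * G x `^ (1 - a))%:E
   <= (\int[mu]_x (F x)%:E) `^ a * (\int[mu]_x (G x)%:E) `^ (1 - a))%E.
Proof.
move=> mF mG F0 G0 /andP[a0 a1].
have [->|an0] := eqVneq a 0.
  rewrite subr0 poweRe0 poweRe1 ?mul1e; last first.
    by apply: integral_ge0 => x _; rewrite lee_fin.
  by under eq_integral do rewrite powRr0 mul1r powRr1//.
have [->|an1] := eqVneq a 1.
  rewrite subrr poweRe0 poweRe1 ?mule1; last first.
    by apply: integral_ge0 => x _; rewrite lee_fin.
  by under eq_integral do rewrite powRr0 mulr1 powRr1//.
have a_gt0 : 0 < a by rewrite lt_neqAle eq_sym an0.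
have a_lt1 : 0 < 1 - a by rewrite subr_gt0 lt_neqAle an1.
have := @hoelder _ _ _ mu (fun x => F x `^ a) (fun x =>
  G x `^ (1 - a)) a^-1 (1 - a)^-1.
rewrite !invrK subrKC; move=> /(_ _ _ _ _ erefl).
have mp (f : T -> R) b : measurable_fun setT f ->
    measurable_fun setT (fun x => f x `^ b).
  by move=> mf; exact: (measurableT_comp (measurable_powR b)).
move=> /(_ (mp _ _ mF) (mp _ _ mG)).
rewrite !invr_gt0 => /(_ a_gt0 a_lt1).
rewrite Lnorm1 unlock !invrK /=.
under eq_integral do rewrite /= ger0_norm ?mulr_ge0 ?powR_ge0//.
move=> h.
have e (f : T -> R) b : 0 < b -> (forall x, 0 <= f x) ->
    (\int[mu]_x `|(f x `^ b)%:E| `^ b^-1)%E = (\int[mu]_x (f x)%:E)%E.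
  move=> b0 f0; apply: eq_integral => x _.
  rewrite abse_EFin ger0_norm ?powR_ge0// poweR_EFin -powRrM mulfV ?gt_eqF//.
  by rewrite powRr1.
rewrite -(e F a a_gt0 F0) -(e G (1 - a) a_lt1 G0); exact: h.
Qed.

(** The two-function inequality is applied to [F] against a geometric mean of [G] and [H], then to
    [G] against [H] with the weights divided by [b + c]. The middle weight may vanish, as it does in
    Young's inequality for [p = 1]. *)
Lemma integral_powR_mul3 F G H (a b c : R) :
  measurable_fun setT F -> measurable_fun setT G -> measurable_fun setT H ->
  (forall x, 0 <= F x) -> (forall x, 0 <= G x) -> (forall x, 0 <= H x) ->
  0 < a -> 0 <= b -> 0 < c -> a + b + c = 1 ->
  (\int[mu]_x (F x `^ a * G x `^ b * H x `^ c)%:E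
   <= (\int[mu]_x (F x)%:E) `^ a * (\int[mu]_x (G x)%:E) `^ b
      * (\int[mu]_x (H x)%:E) `^ c)%E.
Proof.
move=> mF mG mH F0 G0 H0 a0 b0 c0 abc.
pose bc := b + c.
have bc0 : 0 < bc by rewrite /bc; lra.
have mp (f : T -> R) e : measurable_fun setT f ->
    measurable_fun setT (fun x => f x `^ e).
  by move=> mf; exact: (measurableT_comp (measurable_powR e)).
pose K x := G x `^ (b / bc) * H x `^ (1 - b / bc).
have mK : measurable_fun setT K by apply: measurable_funM; exact: mp.
have K0 x : 0 <= K x by rewrite mulr_ge0 ?powR_ge0.
have cE : 1 - b / bc = c / bc by rewrite /bc; field; rewrite gt_eqF.
have aE : 1 - a = bc by rewrite /bc; lra.
have a01 : 0 <= a <= 1 by apply/andP; split; lra.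
have b01 : 0 <= b / bc <= 1.
  by rewrite divr_ge0 ?(ltW bc0)//= ler_pdivrMr// mul1r /bc; lra.
have := integral_powR_mul mF mK F0 K0 a01; rewrite aE => h.
have FE x : F x `^ a * G x `^ b * H x `^ c = F x `^ a * K x `^ bc.
  rewrite /K cE powRM ?powR_ge0// -!powRrM !divfK ?gt_eqF//.
  by rewrite mulrA.
under eq_integral do rewrite FE.
apply: (le_trans h); rewrite -muleA; apply: lee_pmul; rewrite ?poweR_ge0//.
have := integral_powR_mul mG mH G0 H0 b01 => hK.
have := gt0_ler_poweR (ltW bc0) _ _ hK.
rewrite !in_itv/= !leey !andbT => /(_ _ _)/le_trans; apply.
- by apply: integral_ge0 => x _; rewrite lee_fin K0.
- by rewrite mule_ge0 ?poweR_ge0.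
by rewrite poweRM ?poweR_ge0// -!poweRrM cE !divfK ?gt_eqF.
Qed.

End hoelder_weights.

(** * Affine changes of variable on the line *)

Section affine_change_of_variables.
Context {R : realType}.
Local Notation mu := (@lebesgue_measure R).

(** The pushforward under the affine map, multiplied by [|c|], agrees with Lebesgue measure on
    half-open intervals, and uniqueness concludes. A negative [c] moves the closed end of the
    interval to the other side, hence the two cases. *)
Lemma lebesgue_measure_affine (c a : R) (A : set R) : c != 0 -> measurable A ->
  mu ((fun x => c * x + a) @^-1` A) = (`|c|^-1%:E * mu A)%E.
Proof.
move=> c0 mA.
pose T (x : measurableTypeR R) : measurableTypeR R := c * x + a.
have mT : measurable_fun setT T.
  by apply: measurable_funD => //; exact: measurable_funM.
have nc : 0 < `|c| by rewrite normr_gt0.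
pose p : {measure set (measurableTypeR R) -> \bar R} :=
  @measure_function_pushforward__canonical__measure_function_Measure
    _ _ _ _ _ mu T mT.
pose m := mscale (NngNum (normr_ge0 c)) p.
rewrite (@lebesgue_measure_unique R m _ A mA); last first.
  move=> _ [[x y] _ <-] /=; rewrite /m /mscale/= /pushforward /=.
  have -> : T @^-1` `]x, y] = if c < 0 then `[(y - a) / c, (x - a) / c[%classic
      else `]((x - a) / c), ((y - a) / c)]%classic.
    apply/predeqP => z; rewrite /= /T in_itv/=; case: ifPn => cs;
      rewrite /= in_itv/=.
      by rewrite ler_ndivrMr// ltr_ndivlMr// (mulrC z) ltrBlDr lerBrDr andbC.
    have cp : 0 < c by rewrite lt_neqAle eq_sym c0 leNgt.
    by rewrite ltr_pdivrMr// ler_pdivlMr// (mulrC z) ltrBlDr lerBrDr.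
  case: ifPn => cs; rewrite !lebesgue_measure_itv/= !lte_fin.
    rewrite ltr_nM2r ?invr_lt0// ltrD2r; case: ifPn; rewrite ?mule0// => xy.
    rewrite -!EFinB -EFinM ltr0_norm//; congr EFin; field; lra.
  have cp : 0 < c by rewrite lt_neqAle eq_sym c0 leNgt.
  rewrite ltr_pM2r ?invr_gt0// ltrD2r; case: ifPn; rewrite ?mule0// => xy.
  by rewrite -!EFinB -EFinM gtr0_norm//; congr EFin; field; lra.
by rewrite /m /mscale/= muleA -EFinM mulVf ?gt_eqF// mul1e.
Qed.

Lemma ge0_integral_affine1 (c a : R) (f : R -> \bar R) : c != 0 ->
  measurable_fun setT f -> (forall x, 0 <= f x)%E ->
  (\int[mu]_x f (c * x + a)%R = `|c|^-1%:E * \int[mu]_x f x)%E.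
Proof.
move=> c0 mf f0.
pose T (x : measurableTypeR R) : measurableTypeR R := c * x + a.
have mT : measurable_fun setT T.
  by apply: measurable_funD => //; exact: measurable_funM.
have c1 : 0 <= `|c|^-1 by rewrite invr_ge0.
have := @ge0_integral_pushforward _ _ _ _ R T mT mu setT f measurableT mf (fun
  y _ => f0 y).
rewrite preimage_setT /= => <-.
rewrite -(ge0_integral_mscale mu measurableT (NngNum c1))//.
by apply: eq_measure_integral => A mA _; exact: lebesgue_measure_affine.
Qed.

End affine_change_of_variables.

(** * Lebesgue measure and Euclidean balls *)

Section euclidean_space.
Context {R : realType}.
Local Notation mu := (@lebesgue_measure R).

(** Translations ([c = 1]), point reflections ([c = -1]) and dilations all belong to this family, so
    one change of variables serves for every use. *)
Definition taffine n (c : R) (a x : Rn R n) : Rn R n :=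
  [tuple c * (tnth x i : R) + (tnth a i : R) | i < n].

Definition torigin n : Rn R n := [tuple 0 | i < n].

Lemma measurable_fun_tuple d (T : measurableType d) n (f : 'I_n -> T -> R) :
  (forall i, measurable_fun setT (f i)) ->
  measurable_fun setT (fun x => [tuple f i x | i < n] : Rn R n).
Proof.
move=> mf; apply/measurable_fun_tnthP => i.
rewrite (_ : _ \o _ = f i); first exact: mf.
by apply/funext => x /=; rewrite tnth_mktuple.
Qed.

Lemma measurable_taffine n c (a : Rn R n) : measurable_fun setT (taffine c a).
Proof.
apply: measurable_fun_tuple => i; apply: measurable_funD => //.
by apply: measurable_funM => //; exact: measurable_tnth.
Qed.

Lemma measurable_tsub n :
  measurable_fun setT (fun z : Rn R n * Rn R n => tsub z.1 z.2).
Proof.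
apply: measurable_fun_tuple => i; apply: measurable_funB => //.
  exact: (measurableT_comp (@measurable_tnth _ _ n i) measurable_fst).
exact: (measurableT_comp (@measurable_tnth _ _ n i) measurable_snd).
Qed.

Lemma measurable_enorm n : measurable_fun setT (@enorm R n).
Proof.
have msqrt : measurable_fun setT (@Num.sqrt R).
  by apply: continuous_measurable_fun; exact: sqrt_continuous.
have msum : measurable_fun setT (fun x : Rn R n =>
  \sum_(i < n) (tnth x i : R) ^+ 2).
  by apply: measurable_sum => i; apply: measurable_funX; exact: measurable_tnth.
exact: (measurableT_comp msqrt msum).
Qed.

Lemma tsubE n (x a : Rn R n) : tsub x a = taffine 1 (tsub (torigin n) a) x.
Proof. by apply: eq_from_tnth => i; rewrite !tnth_mktuple mul1r sub0r. Qed.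

Lemma tsubEr n (a x : Rn R n) : tsub a x = taffine (-1) a x.
Proof. by apply: eq_from_tnth => i; rewrite !tnth_mktuple mulN1r addrC. Qed.

Lemma tsub0r n (x : Rn R n) : tsub x (torigin n) = x.
Proof. by apply: eq_from_tnth => i; rewrite !tnth_mktuple subr0. Qed.

Lemma measurable_tsubl n (a : Rn R n) : measurable_fun setT (fun x => tsub x a).
Proof. by under eq_fun do rewrite tsubE; exact: measurable_taffine. Qed.

Lemma measurable_tsubr n (a : Rn R n) : measurable_fun setT (tsub a).
Proof.
rewrite (_ : tsub a = taffine (-1) a); last by apply/funext => x; exact: tsubEr.
exact: measurable_taffine.
Qed.

Lemma measurable_eball n (a : Rn R n) r : measurable (eball a r).
Proof.
rewrite -[X in measurable X]setTI (_ : eball a r = (fun x =>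
  enorm (tsub x a)) @^-1` `]-oo, r[).
  by apply: (measurableT_comp (@measurable_enorm n) (@measurable_tsubl n a)) =>
    //.
by apply/seteqP; split => x; rewrite /= in_itv.
Qed.

Lemma enorm_ge0 n (x : Rn R n) : 0 <= enorm x.
Proof. exact: sqrtr_ge0. Qed.

Lemma cauchy_schwarz_sum n (x y : 'I_n -> R) :
  (\sum_i x i * y i) ^+ 2 <= (\sum_i x i ^+ 2) * (\sum_i y i ^+ 2).
Proof.
set X := \sum_i x i ^+ 2; set Y := \sum_i y i ^+ 2; set P := \sum_i x i * y i.
have Y0 : 0 <= Y by apply: sumr_ge0 => i _; exact: sqr_ge0.
have [YE|Yn0] := eqVneq Y 0.
  suff -> : P = 0 by rewrite YE mulr0 expr0n.
  rewrite /P big1// => i _.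
  have /eqP := YE; rewrite psumr_eq0; last by move=> j _; exact: sqr_ge0.
  by move=> /allP/(_ i (mem_index_enum i)); rewrite /= sqrf_eq0 => /eqP ->;
    rewrite mulr0.
have Y_gt0 : 0 < Y by rewrite lt_neqAle eq_sym Yn0.
(* [Y x - P y] is [Y] times the component of [x] orthogonal to [y]; its squared norm is
   [Y (X Y - P^2)]. *)
have : 0 <= \sum_i (Y * x i - P * y i) ^+ 2.
  by apply: sumr_ge0 => i _; exact: sqr_ge0.
have -> : \sum_i (Y * x i - P * y i) ^+ 2 = Y * (X * Y - P ^+ 2).
  under eq_bigr do rewrite sqrrB !exprMn.
  rewrite big_split/= big_split/= -!mulr_sumr -/X -/Y sumrN.
  have -> : \sum_i Y * x i * (P * y i) *+ 2 = Y * P * P *+ 2.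
    rewrite sumrMnl; congr (_ *+ 2); rewrite /P mulr_sumr.
    by apply: eq_bigr => i _; rewrite mulrACA.
  by ring.
by rewrite pmulr_rge0// subr_ge0.
Qed.

Lemma enorm_sub_triangle n (x y z : Rn R n) :
  enorm (tsub x z) <= enorm (tsub x y) + enorm (tsub y z).
Proof.
rewrite /enorm.
set X := \sum_(i < n) (tnth (tsub x y) i : R) ^+ 2.
set Y := \sum_(i < n) (tnth (tsub y z) i : R) ^+ 2.
have X0 : 0 <= X by apply: sumr_ge0 => i _; exact: sqr_ge0.
have Y0 : 0 <= Y by apply: sumr_ge0 => i _; exact: sqr_ge0.
pose P := \sum_(i < n) (tnth (tsub x y) i : R) * (tnth (tsub y z) i : R).
have -> : \sum_(i < n) (tnth (tsub x z) i : R) ^+ 2 = X + P *+ 2 + Y.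
  rewrite /X /P /Y -sumrMnl -!big_split/=; apply: eq_bigr => i _.
  by rewrite -sqrrD; congr (_ ^+ 2); rewrite !tnth_mktuple; ring.
have PXY : P <= Num.sqrt X * Num.sqrt Y.
  rewrite -sqrtrM//; apply: le_trans (ler_norm _) _;
    rewrite -sqrtr_sqr ler_wsqrtr//.
  exact: cauchy_schwarz_sum.
rewrite -(ger0_norm (addr_ge0 (sqrtr_ge0 X) (sqrtr_ge0 Y))) -sqrtr_sqr
  ler_wsqrtr//.
by rewrite sqrrD !sqr_sqrtr// lerD2r lerD2l lerMn2r PXY orbT.
Qed.


Lemma enorm_tsubC n (x y : Rn R n) : enorm (tsub x y) = enorm (tsub y x).
Proof.
rewrite /enorm; congr Num.sqrt; apply: eq_bigr => i _.
by rewrite !tnth_mktuple -sqrrN opprB.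
Qed.

Lemma enorm_taffine n c (a x y : Rn R n) :
  enorm (tsub (taffine c a x) (taffine c a y)) = `|c| * enorm (tsub x y).
Proof.
rewrite /enorm -sqrtr_sqr -sqrtrM ?sqr_ge0// mulr_sumr.
congr Num.sqrt; apply: eq_bigr => i _; rewrite !tnth_mktuple -exprMn.
by congr (_ ^+ 2); ring.
Qed.

(** The induction follows the slicing that defines [lebesgue_n]: a slice of the preimage is the
    preimage of a slice under the map on the remaining coordinates. The slices contribute [|c|^-n]
    and the first coordinate one more factor. *)
Lemma lebesgue_n_affine n (c : R) (a : Rn R n) (A : set (Rn R n)) : c != 0 ->
  measurable A ->
  lebesgue_n n (taffine c a @^-1` A) = ((`|c| ^- n)%:E * lebesgue_n n A)%E.
Proof.
move=> c0; elim: n a A => [|n ih] a A mA.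
  rewrite /= expr0 invr1 mul1e !diracE; congr ((_ : bool)%:R%:E).
  by apply/idP/idP; rewrite !inE /= => h;
    [rewrite (tuple0 [tuple]) -(tuple0 (taffine c a [tuple]))|
     rewrite (tuple0 (taffine c a [tuple])) -(tuple0 [tuple])].
have mS x : measurable [set y : Rn R n | A [tuple of x :: y]].
  have mc : measurable_fun setT (fun y : Rn R n =>
    [the n.+1.-tuple _ of (x : measurableTypeR R) :: y]).
    by apply: measurable_cons => //; exact: measurable_id.
  by rewrite -[X in measurable X]setTI; exact: mc.
pose g x := lebesgue_n n [set y : Rn R n | A [tuple of x :: y]].
pose a' : Rn R n := [tuple of behead a].
have E x : lebesgue_n n [set y : Rn R n | (taffine c a @^-1` A) [tuple of x ::
  y]] =
    ((`|c| ^- n)%:E * g (c * x + (thead a : R))%R)%E.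
  rewrite /g -(ih a')//; congr (lebesgue_n n); apply/predeqP => y /=.
  suff -> : taffine c a [tuple of x :: y] =
      [tuple of (c * x + (thead a : R) : measurableTypeR R) :: taffine c a' y]
        by [].
  apply: eq_from_tnth => i; case: (unliftP ord0 i) => [j|] ->.
    by rewrite !tnth_mktuple !tnthS !tnth_mktuple /= tnth_behead;
      congr (_ + tnth a _);
      apply: val_inj => /=; rewrite inordK// ltnS ltn_ord.
  by rewrite !tnth_mktuple !tnth0.
have g0 x : (0 <= g x)%E by exact: measure_ge0.
have mg : measurable_fun setT g.
  pose B := [set z : measurableTypeR R * Rn R n | A [tuple of z.1 :: z.2]].
  have mB : measurable B.
    have mc : measurable_fun setT (fun z : measurableTypeR R * Rn R n =>
      [the n.+1.-tuple _ of z.1 :: z.2]).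
      by apply: measurable_cons.
    by rewrite -[X in measurable X]setTI; exact: mc.
  have := measurable_fun_xsection (lebesgue_n n) mB.
  rewrite (_ : _ \o _ = g)//; apply/funext => x /=; congr (lebesgue_n n).
  by apply/predeqP => y; rewrite /xsection/= inE.
rewrite /=; under eq_integral do rewrite E.
rewrite ge0_integralZl//; last first.
- apply: (measurableT_comp (f := g)) => //.
  by apply: measurable_funD => //; exact: measurable_funM.
by rewrite (ge0_integral_affine1 (thead a : R) c0 mg g0) muleA -EFinM exprSr
  invfM.
Qed.

Lemma ge0_integral_affine n (c : R) (a : Rn R n) (f : Rn R n ->
  \bar R) : c != 0 ->
  measurable_fun setT f -> (forall x, 0 <= f x)%E ->
  (\int[lebesgue_n n]_x f (taffine c a x)
   = (`|c| ^- n)%:E * \int[lebesgue_n n]_x f x)%E.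
Proof.
move=> c0 mf f0.
have c1 : 0 <= `|c| ^- n by rewrite invr_ge0 exprn_ge0.
have mT := measurable_taffine c a.
have := @ge0_integral_pushforward _ _ _ _ R _ mT (lebesgue_n n) setT f
  measurableT mf (fun y _ => f0 y).
rewrite preimage_setT /= => <-.
rewrite -(ge0_integral_mscale (lebesgue_n n) measurableT (NngNum c1))//.
by apply: eq_measure_integral => // A mA _; exact: lebesgue_n_affine.
Qed.

End euclidean_space.

Section balls.
Context {R : realType}.

Lemma lebesgue_n_cube n (c : R) : 0 < c ->
  lebesgue_n n [set x : Rn R n | forall i, `[- c, c]%classic (tnth x i)] =
  ((c *+ 2) ^+ n)%:E.
Proof.
move=> c0; rewrite (@lebesgue_n_box R n (fun=> `[- c, c]%classic))//.
rewrite (eq_bigr (fun=> (c *+ 2)%:E)); last first.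
  move=> i _; rewrite lebesgue_measure_itv/= lte_fin ifT; last by lra.
  by rewrite -EFinB; congr EFin; rewrite opprK -mulr2n.
by rewrite prodEFin prodr_const card_ord.
Qed.

Lemma tnth_le_enorm n (x : Rn R n) i : `|tnth x i : R| <= enorm x.
Proof.
rewrite -sqrtr_sqr /enorm ler_wsqrtr// (bigD1 i)//= lerDl.
by apply: sumr_ge0 => j _; exact: sqr_ge0.
Qed.

(** Two cubes squeeze the unit ball, which makes its measure positive and finite; every other ball
    is an affine preimage of it. *)
Lemma lebesgue_n_ball n : exists2 v : R, 0 < v &
  forall (a : Rn R n) (r : R), 0 < r ->
    lebesgue_n n (eball a r) = (v * r ^+ n)%:E.
Proof.
pose B := eball (torigin n : Rn R n) 1.
have mB : measurable B := measurable_eball _ _.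
pose e : R := (n.+1%:R)^-1.
have e0 : 0 < e by rewrite invr_gt0.
have lB : (((e *+ 2) ^+ n)%:E <= lebesgue_n n B)%E.
  rewrite -lebesgue_n_cube//; apply: le_measure; rewrite ?inE//.
    rewrite (_ : [set _ | _] = \bigcap_(i in [set: 'I_n])
        ((fun y : Rn R n => tnth y i) @^-1` `[- e, e])); last first.
      by apply/seteqP; split => y By i; [move=> _; exact: By|exact: By].
    apply: fin_bigcap_measurable => // i _; rewrite -[X in measurable X]setTI.
    exact: measurable_tnth.
  move=> x /= xe; rewrite /B /eball /= tsub0r -[ltRHS]sqrtr1 ltr_sqrt//.
  apply: (@le_lt_trans _ _ (\sum_(i < n) e ^+ 2)).
    apply: ler_sum => i _; rewrite -[leLHS]real_normK ?num_real// lerXn2r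
      ?nnegrE ?(ltW e0)//.
    by have := xe i; rewrite in_itv/= -ler_norml.
  rewrite sumr_const card_ord -mulr_natr.
  have eN : e * (n%:R + 1) = 1 by rewrite natr1 /e mulVf.
  have N0 : 0 <= n%:R :> R by [].
  have -> : e ^+ 2 * n%:R = e - e ^+ 2 
    by have : e * (e * (n%:R + 1)) = e; [rewrite eN mulr1|nra].
  have e1 : e <= 1 by nra.
  by nra.
have uB : (lebesgue_n n B <= ((1 *+ 2) ^+ n)%:E)%E.
  rewrite -lebesgue_n_cube//; apply: le_measure; rewrite ?inE//.
    rewrite (_ : [set _ | _] = \bigcap_(i in [set: 'I_n])
        ((fun y : Rn R n => tnth y i) @^-1` `[- 1, 1])); last first.
      by apply/seteqP; split => y By i; [move=> _; exact: By|exact: By].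
    apply: fin_bigcap_measurable => // i _; rewrite -[X in measurable X]setTI.
    exact: measurable_tnth.
  move=> x /=; rewrite /B /eball /= tsub0r => x1 i.
  by rewrite in_itv/= -ler_norml (le_trans (tnth_le_enorm x i))// ltW.
have finB : lebesgue_n n B \is a fin_num.
  by rewrite ge0_fin_numE ?measure_ge0// (le_lt_trans uB) ?ltry.
exists (fine (lebesgue_n n B)).
  rewrite fine_gt0// (lt_le_trans _ lB) ?lte_fin ?exprn_gt0 ?mulrn_wgt0//=.
  by rewrite -ge0_fin_numE ?measure_ge0.
move=> a r r0; pose b := taffine (- r^-1) (torigin n) a.
have -> : eball a r = taffine r^-1 b @^-1` B.
  apply/predeqP => x; rewrite /eball /= /B /eball/=.
  have -> : torigin n = taffine r^-1 b a.
    by apply: eq_from_tnth => i; rewrite !tnth_mktuple; ring.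
  by rewrite enorm_taffine gtr0_norm ?invr_gt0// ltr_pdivrMl// mulr1.
rewrite lebesgue_n_affine ?invr_eq0 ?gt_eqF// gtr0_norm ?invr_gt0//.
by rewrite exprVn invrK -[in LHS](fineK finB) -EFinM mulrC.
Qed.

Lemma enorm_torigin n : enorm (torigin n : Rn R n) = 0.
Proof.
by rewrite /enorm big1 ?sqrtr0// => i _; rewrite tnth_mktuple expr0n.
Qed.

Lemma enorm_eq0 n (x : Rn R n) : (enorm x == 0) = (x == torigin n).
Proof.
apply/eqP/eqP => [x0|->]; last exact: enorm_torigin.
apply: eq_from_tnth => i; rewrite tnth_mktuple; apply/eqP.
by rewrite -normr_le0 -x0 tnth_le_enorm.
Qed.

Lemma enorm_gt0 n (x : Rn R n) : (0 < enorm x) = (x != torigin n).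
Proof. by rewrite lt_neqAle enorm_ge0 andbT eq_sym enorm_eq0. Qed.

Lemma measurable_torigin n : measurable [set torigin n : Rn R n].
Proof.
rewrite (_ : [set _] = @enorm R n @^-1` [set 0]).
  by rewrite -[X in measurable X]setTI; exact: measurable_enorm.
by apply/predeqP => x /=; split => [->|/eqP];
  [exact: enorm_torigin|rewrite enorm_eq0 => /eqP].
Qed.

Lemma lebesgue_n_torigin n : (0 < n)%N -> lebesgue_n n [set torigin n : Rn R n]
  = 0%E.
Proof.
move=> n0; have [v v0 vE] := lebesgue_n_ball n.
apply/eqP; rewrite eq_le measure_ge0 andbT; apply/lee_addgt0Pr => e e0.
(* As [r <= 1] and [n > 0], one has [v r^n <= v r <= e]. In dimension 0 the origin has mass 1. *)
rewrite add0e; pose r := Num.min 1 (e / v).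
have r0 : 0 < r by rewrite lt_min ltr01 divr_gt0.
apply: (@le_trans _ _ (lebesgue_n n (eball (torigin n) r))).
  apply: le_measure; rewrite ?inE; [exact: measurable_torigin|exact:
    measurable_eball|].
  by move=> _ ->; rewrite /eball/= tsub0r enorm_torigin.
rewrite vE// lee_fin -ler_pdivlMl// mulrC.
apply: (@le_trans _ _ r); last by rewrite ge_min lexx orbT.
by rewrite ler_iXnr// ?(ltW r0)// ge_min lexx.
Qed.

Lemma ge0_integral_reflect n (x : Rn R n) (f : Rn R n -> \bar R) :
  measurable_fun setT f -> (forall x, 0 <= f x)%E ->
  (\int[lebesgue_n n]_y f (tsub x y) = \int[lebesgue_n n]_y f y)%E.
Proof.
move=> mf f0; under eq_integral do rewrite tsubEr.
by rewrite ge0_integral_affine ?oppr_eq0 ?oner_eq0// normrN1 expr1n invr1 mul1e.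
Qed.

Lemma ge0_integral_translate n (a : Rn R n) (f : Rn R n -> \bar R) :
  measurable_fun setT f -> (forall x, 0 <= f x)%E ->
  (\int[lebesgue_n n]_x f (tsub x a) = \int[lebesgue_n n]_x f x)%E.
Proof.
move=> mf f0; under eq_integral do rewrite tsubE.
by rewrite ge0_integral_affine ?oner_eq0// normr1 expr1n invr1 mul1e.
Qed.

End balls.

(** * Monotone minorants and radial integrals *)

Section integral_constants.
Context d (T : measurableType d) (R : realType).
Variable mu : {measure set T -> \bar R}.

Lemma integral_ge_cst (D A : set T) (f : T -> \bar R) (c : R) :
  measurable A -> A `<=` D -> 0 <= c -> (forall x, D x -> 0 <= f x)%E ->
  (forall x, A x -> c%:E <= f x)%E ->
  (c%:E * mu A <= \int[mu]_(x in D) f x)%E.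
Proof.
move=> mA AD c0 f0 cf.
rewrite -(integral_cst mu mA) [leLHS]integral_mkcond [leRHS]integral_mkcond.
apply: le_integral_nonneg => x _; rewrite /patch; case: ifPn => xA //.
- by rewrite ifT ?cf//; [exact: set_mem|apply/mem_set/AD/set_mem].
by case: ifPn => // /set_mem; exact: f0.
Qed.

Lemma integral_le_cst (D : set T) (f : T -> \bar R) (c : R) :
  measurable D -> (forall x, D x -> 0 <= f x)%E ->
  (forall x, D x -> f x <= c%:E)%E ->
  (\int[mu]_(x in D) f x <= c%:E * mu D)%E.
Proof.
move=> mD f0 fc; rewrite -(integral_cst mu mD).
exact: le_integral_nonneg.
Qed.

End integral_constants.

Section regularization.
Context {R : realType}.
Implicit Type h : R -> R.

(* Lebesgue integrals of non-measurable functions are lower integrals, so an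
   almost decreasing function may be replaced by a monotone minorant. *)
Lemma almost_decreasing_minorant h : pos_fun h -> almost_decreasing h ->
  exists g : R -> R, exists2 c : R, 0 < c &
    [/\ measurable_fun setT g, g 0 = 0, (forall r, 0 <= g r),
        (forall r s, 0 < r -> r <= s -> g s <= g r) &
        (forall r, 0 < r -> c * h r <= g r <= h r)].
Proof.
move=> h0 [c c0 hc].
(* The minorant at [r] is the infimum of [h] over []0, r]]. In the variable [u = ln r] it is
   monotone on the whole line, hence measurable; the indicator fixes the value 0 for [r <= 0]. *)
pose G u := inf [set h s | s in `]0, expR u]%classic].
pose g r := \1_`]0, +oo[%classic r * G (ln r).
have hi u : has_inf [set h s | s in `]0, expR u]%classic].
  split; first by exists (h (expR u)), (expR u) => //=;
    rewrite in_itv/= expR_gt0/=.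
  by exists 0 => _ [s /= + <-]; rewrite in_itv/= => /andP[s0 _]; exact/ltW/h0.
have gE r : 0 < r -> g r = G (ln r).
  by move=> r0; rewrite /g indicE mem_set ?mul1r//= in_itv/= r0.
have g0 r : r <= 0 -> g r = 0.
  move=> r0; rewrite /g indicE memNset ?mul0r//= in_itv/= andbT.
  by apply/negP; rewrite -leNgt.
have Gmono : {homo G : u v / u <= v >-> v <= u}.
  move=> u v uv; apply: lb_le_inf; first by case: (hi u).
  move=> _ [s /= + <-]; rewrite in_itv/= => /andP[s0 su].
  apply: ge_inf; first by case: (hi v).
  by exists s => //=; rewrite in_itv/= s0 (le_trans su)// ler_expR.
have gc r : 0 < r -> c * h r <= g r <= h r.
  move=> r0; rewrite gE// /G lnK ?posrE//; apply/andP; split.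
    apply: lb_le_inf; first by case: (hi (ln r)); rewrite lnK ?posrE.
    by move=> _ [s /= + <-]; rewrite in_itv/= => /andP[s0 sr]; exact: hc.
  by apply: ge_inf; [case: (hi (ln r)); rewrite lnK ?posrE|exists r => //=;
    rewrite in_itv/= r0 lexx].
exists g; exists c; [exact: c0|split; last exact: gc].
- apply: measurable_funM; first exact: measurable_indic.
  have mG : measurable_fun setT (G : measurableTypeR R -> measurableTypeR R).
    by apply: nonincreasing_measurable => // u v; exact: Gmono.
  exact: (measurableT_comp mG (@measurable_ln R)).
- exact: g0.
- move=> r; have [r0|r0] := leP r 0; first by rewrite g0.
  by have /andP[+ _] := gc _ r0; apply: le_trans; rewrite mulr_ge0// ltW// h0.
- move=> r s r0 rs; have s0 := lt_le_trans r0 rs.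
  by rewrite !gE//; apply: Gmono; rewrite ler_ln ?posrE.
Qed.

End regularization.

Section radial_tonelli.
Context {R : realType}.
Local Notation mu := (@lebesgue_measure R).

Lemma integral_cst_indic d (T : measurableType d) (m : {measure set T ->
  \bar R})
    (A : set T) (c : R) : measurable A -> 0 <= c ->
  (\int[m]_x (c * \1_A x)%:E = c%:E * m A)%E.
Proof.
move=> mA c0; under eq_integral do rewrite EFinM.
rewrite ge0_integralZl//.
- by rewrite integral_indic// setIT.
- by apply/measurable_EFinP; exact: measurable_indic.
Qed.

Lemma measurable_enorm_lt n (c : R) (x : Rn R n) : measurable
  [set z : Rn R n * measurableTypeR R | enorm (tsub x z.1) < c * (z.2 : R)].
Proof.
have m1 : measurable_fun setT (fun z : Rn R n * measurableTypeR R =>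
  enorm (tsub x z.1)).
  apply: (measurableT_comp (@measurable_enorm R n)).
  exact: (measurableT_comp (@measurable_tsubr R n x) measurable_fst).
have m2 : measurable_fun setT (fun z : Rn R n * measurableTypeR R =>
  c * (z.2 : R)).
  by apply: measurable_funM.
have := @measurable_fun_ltr _ _ R setT _ _ m1 m2.
by move=> /(_ measurableT [set true]); rewrite setTI; apply.
Qed.

(* Tonelli, after writing [h |x|] as at most [2 \int_(|x|/2)^|x| h r / r dr]. *)
Lemma radial_integral_le n : exists2 C : R, 0 < C & forall (h : R -> R) rho,
  0 < rho -> measurable_fun setT h -> h 0 = 0 -> (forall r, 0 <= h r) ->
  (forall r s, 0 < r -> r <= s -> h s <= h r) ->
  (\int[lebesgue_n n]_(x in eball (torigin n) rho) (h (enorm x))%:E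
   <= C%:E * \int[mu]_(r in `]0%R, rho]) (h r * r `^ (n%:R - 1))%:E)%E.
Proof.
have [v v0 vE] := @lebesgue_n_ball R n.
(* The first 2 comes from the interval [](|x|/2), |x|]] of length [|x|/2]; [v * 2 ^+ n] comes from
   the volume of the ball of radius [2 r] left after exchanging the integrals. *)
exists (2 * v * 2 ^+ n); first by rewrite !mulr_gt0// exprn_gt0.
move=> h rho rho0 mh h0 hge0 hmono.
pose S := [set z : Rn R n * measurableTypeR R | enorm (tsub (torigin n) z.1) <
  2 * (z.2 : R)].
have mS : measurable S := measurable_enorm_lt _ _.
pose k (r : R) := 2 * h r * r `^ (-1) * \1_`]0, rho]%classic r.
have k0 r : 0 <= k r by rewrite /k !mulr_ge0// powR_ge0.
have mk : measurable_fun setT k.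
  apply: measurable_funM; last exact: measurable_indic.
  apply: measurable_funM; last exact: measurable_powR.
  by apply: measurable_funM.
pose F (z : Rn R n * measurableTypeR R) := (k z.2 * \1_S z)%:E.
have F0 z : (0 <= F z)%E by rewrite lee_fin mulr_ge0.
have mF : measurable_fun setT F.
  apply/measurable_EFinP; apply: measurable_funM; last exact: measurable_indic.
  exact: (measurableT_comp (f := k) mk measurable_snd).
have SE x r : S (x, r) <-> enorm x < 2 * r by rewrite /S/= enorm_tsubC tsub0r.
have step1 x : eball (torigin n) rho x -> ((h (enorm x))%:E <= \int[mu]_r F (x,
  r))%E.
  rewrite /eball/= tsub0r => xrho.
  (* At the origin that interval is empty, and [h 0 = 0] makes the bound trivial. *)
  have [->|x0] := eqVneq (enorm x) 0; first by rewrite h0 integral_ge0.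
  have {}x0 : 0 < enorm x by rewrite lt_neqAle eq_sym x0 enorm_ge0.
  set e := enorm x in x0 xrho *.
  have -> : (h e)%:E = ((2 * h e * e^-1)%:E * mu `](e / 2)%R, e]%classic)%E.
    rewrite lebesgue_measure_itv/= lte_fin ifT; last by lra.
    by rewrite -EFinB -EFinM; congr EFin; field; rewrite gt_eqF.
  apply: integral_ge_cst => //.
    by rewrite !mulr_ge0// invr_ge0 ltW.
  move=> r /=; rewrite in_itv/= => /andP[r1 r2].
  have r0 : 0 < r by apply: lt_trans r1; rewrite divr_gt0.
  rewrite lee_fin /k !indicE/= !mem_set ?mulr1/=; last 2 first.
  - by apply/SE; rewrite -/e; lra.
  - by rewrite in_itv/= r0/= (le_trans r2)// ltW.
  rewrite powR_inv1 ?(ltW r0)// ler_pM//.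
  - by rewrite mulr_ge0.
  - by rewrite invr_ge0 ltW.
  - by rewrite ler_pM2l// hmono.
  - by rewrite lef_pV2 ?posrE.
apply: (@le_trans _ _ (\int[lebesgue_n n]_x \int[mu]_r F (x, r))%E).
  rewrite integral_mkcond; apply: le_integral_nonneg => x _.
    by rewrite /patch; case: ifPn => // _; rewrite lee_fin.
  rewrite /patch; case: ifPn => [/set_mem|_]; first exact: step1.
  exact: integral_ge0.
rewrite fubini_tonelli//.
under eq_integral => r _.
  rewrite (_ : (\int[_]_x F (x, r))%E = (k r * (v * 2 ^+ n * r ^+ n))%:E);
    first over.
  have [r0|r0] := leP r 0.
    rewrite integral0_eq; last first.
      by move=> x _; rewrite /F /k/= indicE memNset ?mulr0 ?mul0r//= in_itv/=
        ltNge r0.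
    by rewrite /k indicE memNset ?mulr0 ?mul0r//= in_itv/= ltNge r0.
  have -> : (fun x => F (x, r)) = (fun x => (k r * \1_(eball (torigin n : Rn R
    n) (2 * r)) x)%:E).
    apply/funext => x; rewrite /F/= !indicE;
      congr ((_ * (nat_of_bool _)%:R)%:E).
    by apply/idP/idP; rewrite !inE; [move=> /SE|move=> h'; apply/SE];
      [|move: h']; rewrite /eball/= tsub0r.
  rewrite integral_cst_indic//; last exact: measurable_eball.
  transitivity ((k r)%:E * (v * (2 * r) ^+ n)%:E)%E; last
    by rewrite -EFinM exprMn (mulrA v).
  by congr (_ * _)%E; apply: vE; rewrite mulr_gt0.
rewrite -ge0_integralZl//; last 3 first.
- apply: measurable_funTS; apply/measurable_EFinP.
  by apply: measurable_funM => //; exact: measurable_powR.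
- by move=> r _; rewrite lee_fin mulr_ge0// powR_ge0.
- by rewrite lee_fin !mulr_ge0 ?ltW// exprn_gt0.
rewrite [leRHS]integral_mkcond; apply: le_integral_nonneg => r _.
  rewrite lee_fin; have [r0|r0] := leP r 0.
    by rewrite /k indicE memNset ?mulr0 ?mul0r//= in_itv/= ltNge r0.
  by rewrite mulr_ge0// !mulr_ge0// ?exprn_ge0// ltW.
rewrite /patch /k indicE; case: ifPn => [/set_mem|_]; last
  by rewrite mulr0 mul0r.
rewrite /= in_itv/= => /andP[r0 _]; rewrite mulr1 -EFinM lee_fin.
have -> : r `^ (n%:R - 1) = r ^+ n * r `^ (-1).
  by rewrite powRD ?(gt_eqF r0) ?implybT// powR_mulrn ?(ltW r0).
by rewrite le_eqVlt; apply/orP; left; apply/eqP; ring.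
Qed.

(* Tonelli, with [|z|^-a <= 2^(a+1) \int_|z|^(2|z|) r^(-a-1) dr]. *)
Lemma integral_tail_le n (x : Rn R n) (f : Rn R n -> R) (a rho : R) :
  0 < a -> 0 < rho -> measurable_fun setT f -> (forall y, 0 <= f y) ->
  (\int[lebesgue_n n]_(y in ~` eball x rho) (enorm (tsub x y) `^ (- a) * f y)%:E
   <= (2 `^ (a + 1))%:E * \int[mu]_(r in `[rho, +oo[)
        ((r `^ (- a - 1))%:E * \int[lebesgue_n n]_(y in eball x r) (f y)%:E))%E.
Proof.
move=> a0 rho0 mf f0.
pose S := [set z : Rn R n * measurableTypeR R | enorm (tsub x z.1) < 1 * (z.2 :
  R)].
have mS : measurable S := measurable_enorm_lt _ _.
pose k (r : R) := 2 `^ (a + 1) * r `^ (- a - 1) * \1_`[rho, +oo[%classic r.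
have k0 r : 0 <= k r by rewrite /k !mulr_ge0// powR_ge0.
have mk : measurable_fun setT k.
  apply: measurable_funM; last exact: measurable_indic.
  by apply: measurable_funM => //; exact: measurable_powR.
pose F (z : Rn R n * measurableTypeR R) := (k z.2 * (f z.1 * \1_S z))%:E.
have F0 z : (0 <= F z)%E by rewrite lee_fin mulr_ge0// mulr_ge0.
have mF : measurable_fun setT F.
  apply/measurable_EFinP; apply: measurable_funM.
    exact: (measurableT_comp (f := k) mk measurable_snd).
  apply: measurable_funM; last exact: measurable_indic.
  exact: (measurableT_comp (f := f) mf measurable_fst).
have SE y r : S (y, r) <-> enorm (tsub x y) < r by rewrite /S/= mul1r.
have step1 y : (~` eball x rho) y ->
    ((enorm (tsub x y) `^ (- a) * f y)%:E <= \int[mu]_r F (y, r))%E.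
  rewrite /eball/= enorm_tsubC => /negP; rewrite -leNgt => xrho.
  set e := enorm (tsub x y) in xrho *.
  have e0 : 0 < e := lt_le_trans rho0 xrho.
  (* The interval []e, 2e]] has length [e], and on it [r^(-a-1)] is at least its value at [2e]; this
     produces the factor [2^(a+1)]. *)
  have -> : (e `^ (- a) * f y)%:E =
      ((2 `^ (a + 1) * (2 * e) `^ (- a - 1) * f y)%:E * mu `]e,
        (2 * e)%R]%classic)%E.
    rewrite lebesgue_measure_itv/= lte_fin ifT; last by lra.
    rewrite -EFinB -EFinM; congr EFin.
    have -> : 2 * e - e = e by lra.
    rewrite powRM ?(ltW e0)// mulrA -powRD ?pnatr_eq0 ?implybT//.
    have -> : a + 1 + (- a - 1) = 0 by lra.
    rewrite powRr0 mul1r mulrAC; congr (_ * _).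
    rewrite powRD ?(gt_eqF e0) ?implybT// powR_inv1 ?(ltW e0)// -mulrA mulVf
      ?mulr1//.
    by rewrite gt_eqF.
  apply: integral_ge_cst => //.
    by rewrite !mulr_ge0// powR_ge0.
  move=> r /=; rewrite in_itv/= => /andP[r1 r2].
  have r0 : 0 < r by apply: lt_trans r1.
  rewrite lee_fin /k !indicE/= !mem_set ?mulr1/=; last 2 first.
  - exact/SE.
  - by rewrite in_itv/= andbT (le_trans xrho)// ltW.
  apply: ler_wpM2r => //; apply: ler_wpM2l; first exact: powR_ge0.
  have -> : - a - 1 = - (a + 1) by lra.
  rewrite !powRN lef_pV2 ?posrE ?powR_gt0//; last by rewrite mulr_gt0.
  apply: ge0_ler_powR; rewrite ?nnegrE ?(ltW r0)//; first by lra.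
  by rewrite mulr_ge0 ?ltW.
apply: (@le_trans _ _ (\int[lebesgue_n n]_y \int[mu]_r F (y, r))%E).
  rewrite integral_mkcond; apply: le_integral_nonneg => y _.
    by rewrite /patch; case: ifPn => // _; rewrite lee_fin mulr_ge0// powR_ge0.
  rewrite /patch; case: ifPn => [/set_mem|_]; first exact: step1.
  exact: integral_ge0.
rewrite fubini_tonelli//.
(* Without the weight [k], the sections of the integrand integrate to the ball integrals of [f];
   Tonelli's theorem then shows that these are measurable in [r]. *)
pose F1 (z : Rn R n * measurableTypeR R) := (f z.1 * \1_S z)%:E.
have F10 z : (0 <= F1 z)%E by rewrite lee_fin mulr_ge0.
have mF1 : measurable_fun setT F1.
  apply/measurable_EFinP; apply: measurable_funM; last exact: measurable_indic.
  exact: (measurableT_comp (f := f) mf measurable_fst).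
pose G (r : measurableTypeR R) := (\int[lebesgue_n n]_(y in eball x r) (f
  y)%:E)%E.
have G1 r : (\int[lebesgue_n n]_y F1 (y, r))%E = G r.
  rewrite /G [in RHS]integral_mkcond.
  apply: eq_integral => y _; rewrite /F1/= /patch.
  case: ifPn => [/set_mem|/negP] yx; rewrite indicE.
    by rewrite mem_set ?mulr1//; apply/SE; rewrite enorm_tsubC.
  rewrite memNset ?mulr0// => /SE; rewrite enorm_tsubC => /mem_set.
  by move=> h; apply: yx.
have G0 r : (0 <= G r)%E by apply: integral_ge0 => y _; rewrite lee_fin.
have mG : measurable_fun setT G.
  have := @measurable_fun_fubini_tonelli_G _ _ _ _ R (@lebesgue_n R n) _ mF1
    F10.
  by rewrite /fubini_G (_ : (fun y => _) = G)//; apply/funext => r; exact: G1.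
have GE r : (\int[lebesgue_n n]_y F (y, r))%E = ((k r)%:E * G r)%E.
  rewrite -G1 -ge0_integralZl//; last 2 first.
  - exact: (measurableT_comp (f := F1) mF1 (pair2_measurable _)).
  - by rewrite lee_fin k0.
under eq_integral do rewrite GE.
have kE r : `[rho, +oo[%classic r -> k r = 2 `^ (a + 1) * r `^ (- a - 1).
  by move=> rr; rewrite /k indicE mem_set ?mulr1.
rewrite -ge0_integralZl//; last 2 first.
- apply: measurable_funTS; apply: emeasurable_funM => //.
  by apply/measurable_EFinP; exact: measurable_powR.
- by move=> r _; rewrite mule_ge0 ?lee_fin ?powR_ge0 ?G0.
rewrite [leRHS]integral_mkcond; apply: le_integral_nonneg => r _.
  by rewrite mule_ge0 ?lee_fin ?integral_ge0// => y _; rewrite lee_fin.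
rewrite /patch; case: ifPn => [/set_mem rr|rr]; first
  by rewrite muleA -EFinM kE.
by rewrite /k indicE (negbTE rr) mulr0 mul0e.
Qed.

End radial_tonelli.

(** * Young's inequality and the Bessel-Riesz kernel *)

Section young.
Context {R : realType} {n : nat}.
Local Notation mu := (@lebesgue_n R n).

Lemma measurable_powR_fun d (T : measurableType d) (f : T -> R) b :
  measurable_fun setT f -> measurable_fun setT (fun x => f x `^ b).
Proof. by move=> mf; exact: (measurableT_comp (measurable_powR b)). Qed.

(** The product [k g] is factored as [(k^s g^p)^(1/q) (k^s)^(1/s - 1/q) (g^p)^(1/p - 1/q)], whose
    exponents add up to 1. Hoelder's inequality in [y] and the power [q] leave [k^s * g^p] as the
    only factor depending on [x], and its integral is at most [A G] by Tonelli and translation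
    invariance. *)
Lemma young_convolution (k g : Rn R n -> R) (s p q A G : R) :
  measurable_fun setT k -> measurable_fun setT g ->
  (forall x, 0 <= k x) -> (forall x, 0 <= g x) ->
  1 < s -> 1 <= p -> 0 < q -> s^-1 + p^-1 = 1 + q^-1 ->
  0 <= A -> 0 <= G ->
  (\int[mu]_x (k x `^ s)%:E <= A%:E)%E -> (\int[mu]_x (g x `^ p)%:E <= G%:E)%E
    ->
  (\int[mu]_x (\int[mu]_y (k (tsub x y) * g y)%:E) `^ q
   <= (A `^ (q / s) * G `^ (q / p))%:E)%E.
Proof.
move=> mk mg k0 g0 s1 p1 q0 spq A0 G0 kA gG.
have s0 : 0 < s by exact: lt_trans s1.
have p0 : 0 < p by exact: lt_le_trans p1.
pose a := q^-1; pose b := s^-1 - q^-1; pose c := p^-1 - q^-1.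
have a0 : 0 < a by rewrite invr_gt0.
have pinv : p^-1 <= 1 by rewrite invf_le1.
have sinv : s^-1 < 1 by rewrite invf_lt1.
have b0 : 0 <= b by rewrite /b; lra.
have c0 : 0 < c by rewrite /c; lra.
have abc : a + b + c = 1 by rewrite /a /b /c; lra.
have mk2 x : measurable_fun setT (fun y => k (tsub x y)).
  exact: (measurableT_comp mk (@measurable_tsubr R n x)).
have mks x : measurable_fun setT (fun y => k (tsub x y) `^ s).
  exact: measurable_powR_fun.
have mgp : measurable_fun setT (fun y => g y `^ p)
  by exact: measurable_powR_fun.
pose W x := (\int[mu]_y (k (tsub x y) `^ s * g y `^ p)%:E)%E.
have W0 x : (0 <= W x)%E.
  by apply: integral_ge0 => y _; rewrite lee_fin mulr_ge0 ?powR_ge0.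
pose F (z : Rn R n * Rn R n) := (k (tsub z.1 z.2) `^ s * g z.2 `^ p)%:E.
have F0 z : (0 <= F z)%E by rewrite lee_fin mulr_ge0 ?powR_ge0.
have mF : measurable_fun setT F.
  apply/measurable_EFinP; apply: measurable_funM.
    by apply: measurable_powR_fun; exact: (measurableT_comp mk
      (@measurable_tsub R n)).
  exact: (measurableT_comp mgp measurable_snd).
have mW : measurable_fun setT W.
  exact: (@measurable_fun_fubini_tonelli_F _ _ _ _ R mu F mF F0).
have intW : (\int[mu]_x W x <= (A * G)%:E)%E.
  rewrite (fubini_tonelli F)//.
  under eq_integral => y _.
    rewrite /F /=; under eq_integral do rewrite mulrC EFinM.
    rewrite ge0_integralZl//; last 3 first.
    - apply/measurable_EFinP; apply: measurable_powR_fun.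
      exact: (measurableT_comp mk (@measurable_tsubl R n y)).
    - by move=> x _; rewrite lee_fin powR_ge0.
    - by rewrite lee_fin powR_ge0.
    rewrite (@ge0_integral_translate R n y (fun x => (k x `^ s)%:E));
      last 2 first.
    - by apply/measurable_EFinP; exact: measurable_powR_fun.
    - by move=> x; rewrite lee_fin powR_ge0.
    over.
  rewrite ge0_integralZr//; last 3 first.
  - exact/measurable_EFinP.
  - by move=> x _; rewrite lee_fin powR_ge0.
  - by apply: integral_ge0 => x _; rewrite lee_fin powR_ge0.
  rewrite muleC EFinM; apply: lee_pmul => //.
  - by apply: integral_ge0 => x _; rewrite lee_fin powR_ge0.
  - by apply: integral_ge0 => x _; rewrite lee_fin powR_ge0.
have step x : ((\int[mu]_y (k (tsub x y) * g y)%:E) `^ q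
    <= W x * (A `^ (b * q) * G `^ (c * q))%:E)%E.
  have kg y : k (tsub x y) * g y =
      (k (tsub x y) `^ s * g y `^ p) `^ a * (k (tsub x y) `^ s) `^ b * (g y `^
        p) `^ c.
    rewrite powRM ?powR_ge0// -!powRrM.
    have e (u w z t : R) : u * w * z * t = (u * z) * (w * t) by ring.
    rewrite e -!powRD -?mulrDr /a /b /c !subrKC ?mulfV ?(gt_eqF s0) ?(gt_eqF
      p0) ?oner_eq0//.
    by rewrite !powRr1.
  under eq_integral do rewrite kg.
  have h := @integral_powR_mul3 _ _ R mu (fun y => k (tsub x y) `^ s * g y `^ p)
     (fun y => k (tsub x y) `^ s) (fun y => g y `^ p) a b c
     (measurable_funM (mks x) mgp) (mks x) mgp
     (fun y => mulr_ge0 (powR_ge0 _ _) (powR_ge0 _ _))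
     (fun y => powR_ge0 _ _) (fun y => powR_ge0 _ _) a0 b0 c0 abc.
  have ks : (\int[mu]_y (k (tsub x y) `^ s)%:E <= A%:E)%E.
    rewrite (@ge0_integral_reflect R n x (fun x => (k x `^ s)%:E))//.
    - by apply/measurable_EFinP; exact: measurable_powR_fun.
    - by move=> y; rewrite lee_fin powR_ge0.
  apply: (@le_trans _ _ ((W x `^ a * (A `^ b)%:E * (G `^ c)%:E) `^ q)%E).
    apply: gt0_ler_poweR; rewrite ?(ltW q0)//.
    - rewrite in_itv/= leey andbT; apply: integral_ge0 => y _.
      by rewrite lee_fin !mulr_ge0 ?powR_ge0.
    - by rewrite in_itv/= leey andbT !mule_ge0 ?poweR_ge0// lee_fin powR_ge0.
    apply: (le_trans h); rewrite -!poweR_EFin; apply: lee_pmul.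
    - by rewrite mule_ge0 ?poweR_ge0.
    - exact: poweR_ge0.
    - apply: lee_pmul; rewrite ?poweR_ge0//.
      apply: gt0_ler_poweR => //; rewrite in_itv/= leey andbT//.
      by apply: integral_ge0 => y _; rewrite lee_fin powR_ge0.
    - apply: gt0_ler_poweR => //; rewrite ?(ltW c0)// in_itv/= leey andbT//.
      by apply: integral_ge0 => y _; rewrite lee_fin powR_ge0.
  rewrite -muleA -EFinM poweRM ?poweR_ge0 ?lee_fin ?mulr_ge0 ?powR_ge0//.
  rewrite -poweRrM mulVf ?gt_eqF// poweRe1// poweR_EFin.
  by rewrite powRM ?powR_ge0// -!powRrM.
apply: (@le_trans _ _ (\int[mu]_x (W x * (A `^ (b * q) * G `^ (c * q))%:E))%E).
  by apply: le_integral_nonneg => x _; [exact: poweR_ge0|exact: step].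
rewrite ge0_integralZr//; last by rewrite lee_fin mulr_ge0 ?powR_ge0.
apply: (@le_trans _ _ ((A * G)%:E * (A `^ (b * q) * G `^ (c * q))%:E)%E).
  by apply: lee_wpmul2r => //; rewrite lee_fin mulr_ge0 ?powR_ge0.
have -> : q / s = 1 + b * q by rewrite /b; field; rewrite !gt_eqF.
have -> : q / p = 1 + c * q by rewrite /c; field; rewrite !gt_eqF.
have bq : 1 + b * q != 0 by rewrite gt_eqF// ltr_wpDr// mulr_ge0// ltW.
have cq : 1 + c * q != 0 by rewrite gt_eqF// ltr_wpDr// mulr_ge0// ltW.
rewrite !powRD ?(negbTE bq) ?(negbTE cq)// !powRr1// -EFinM lee_fin.
by rewrite mulrACA.
Qed.

End young.

Section radially_decreasing.
Context {R : realType} {n : nat}.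
Hypothesis n0 : (0 < n)%N.

(** The lower bound is asked only off the origin, since the kernel takes the value 0 there; the
    origin is a null set. *)
Lemma ge_integral_centered_ball (f : Rn R n -> \bar R) (c v r : R) : 0 <= c ->
  lebesgue_n n (eball (torigin n : Rn R n) r) = (v * r ^+ n)%:E ->
  (forall x, 0 <= f x)%E ->
  (forall x, (0 < enorm x < r)%R -> c%:E <= f x)%E ->
  ((c * (v * r ^+ n))%:E <= \int[lebesgue_n n]_(x in eball (torigin n) r) f
    x)%E.
Proof.
move=> c0 vE f0 cf; set B := eball _ r in vE *.
have mB : measurable B := measurable_eball _ _.
have mO := @measurable_torigin R n.
have mBO : measurable (B `\` [set torigin n]) by exact: measurableD.
have vB : ((v * r ^+ n)%:E <= lebesgue_n n (B `\` [set torigin n]))%E.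
  rewrite -vE -[leRHS]adde0 -(lebesgue_n_torigin n0).
  apply: le_trans (measureU2 _ mBO mO).
  apply: le_measure; rewrite ?inE//; first exact: measurableU.
  move=> x Bx; have [->|/eqP x0] := eqVneq x (torigin n); first by right.
  by left.
apply: (@le_trans _ _ (c%:E * lebesgue_n n (B `\` [set torigin n]))%E).
  by rewrite EFinM; apply: lee_wpmul2l; rewrite ?lee_fin.
apply: integral_ge_cst => // x [Bx /eqP x0].
by apply: cf; rewrite enorm_gt0 x0 /=; move: Bx; rewrite /B /eball/= tsub0r.
Qed.

End radially_decreasing.

Section kernel.
Context {R : realType} {n : nat} (alpha gamma : R).
Hypotheses (alpha_lt : alpha < n%:R) (gamma_ge0 : 0 <= gamma).
Local Notation K := (@bessel_riesz_kernel R n alpha gamma).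

Lemma bessel_riesz_kernel_ge0 (x : Rn R n) : 0 <= K x.
Proof. by rewrite divr_ge0 ?powR_ge0. Qed.

(** Both the numerator and the inverse of the denominator decrease with the norm, whatever
    [alpha < n] and [gamma >= 0]. The smaller point must not be the origin, because of the value 0
    there. *)
Lemma bessel_riesz_kernel_le (x y : Rn R n) : 0 < enorm x ->
  enorm x <= enorm y -> K y <= K x.
Proof.
move=> x0 xy; have y0 := lt_le_trans x0 xy.
rewrite /bessel_riesz_kernel ler_pM ?powR_ge0 ?invr_ge0 ?powR_ge0//.
  rewrite -(opprB n%:R) !powRN lef_pV2 ?posrE ?powR_gt0//.
  by apply: ge0_ler_powR; rewrite ?nnegrE ?enorm_ge0// subr_ge0 ltW.
rewrite lef_pV2 ?posrE ?powR_gt0 ?addr_gt0//.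
by apply: ge0_ler_powR; rewrite ?nnegrE ?addr_ge0 ?enorm_ge0// lerD2l.
Qed.

Lemma bessel_riesz_kernel0 : K (torigin n) = 0.
Proof.
by rewrite /bessel_riesz_kernel enorm_torigin powR0 ?mul0r// lt_eqF// subr_lt0.
Qed.

Lemma measurable_bessel_riesz_kernel : measurable_fun setT K.
Proof.
rewrite /bessel_riesz_kernel; under eq_fun do rewrite -powRN.
apply: measurable_funM; apply: measurable_powR_fun;
  first exact: measurable_enorm.
by apply: measurable_funD => //; exact: measurable_enorm.
Qed.

End kernel.

(** * Powers, roots and bounds drawn from Morrey norms *)

Section poweR_bounds.
Context {R : realType}.

Lemma le_poweR_of_root (c p N : R) (I : \bar R) : 0 < c -> 0 < p ->
  (0 <= I)%E ->
  (c%:E * I `^ p^-1 <= N%:E)%E -> (I <= ((N / c) `^ p)%:E)%E.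
Proof.
move=> c0 p0 I0 h.
have {}h : (I `^ p^-1 <= (N / c)%:E)%E by rewrite mulrC EFinM lee_pdivlMl.
have Nc : 0 <= N / c by rewrite -lee_fin (le_trans _ h)// poweR_ge0.
have := gt0_ler_poweR (ltW p0) _ _ h.
rewrite -poweRrM mulVf ?gt_eqF// poweRe1//; apply;
  rewrite in_itv/= leey andbT//.
exact: poweR_ge0.
Qed.

Lemma root_le_of_poweR (p D : R) (I : \bar R) : 0 < p -> (0 <= I)%E -> 0 <= D ->
  (I <= (D `^ p)%:E)%E -> (I `^ p^-1 <= D%:E)%E.
Proof.
move=> p0 I0 D0 h.
have := @gt0_ler_poweR _ p^-1 _ _ _ _ _ h;
  rewrite poweR_EFin -powRrM mulfV ?gt_eqF//.
rewrite powRr1//; apply; rewrite ?invr_ge0 ?(ltW p0)// in_itv/= leey andbT//.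
by rewrite lee_fin powR_ge0.
Qed.

(** The sum is at most twice the larger term, so convexity does not enter. *)
Lemma powR_add_le (a b p : R) : 0 <= a -> 0 <= b -> 0 < p ->
  (a + b) `^ p <= 2 `^ p * (a `^ p + b `^ p).
Proof.
move=> a0 b0 p0.
have mono (x y : R) : 0 <= x -> x <= y -> x `^ p <= y `^ p.
  by move=> x0 xy; apply: ge0_ler_powR; rewrite ?nnegrE ?(ltW p0)// (le_trans
    x0).
have [ab|/ltW ab] := leP a b.
  apply: (@le_trans _ _ ((2 * b) `^ p)); first by apply: mono; lra.
  by rewrite powRM// ler_wpM2l ?powR_ge0// lerDr powR_ge0.
apply: (@le_trans _ _ ((2 * a) `^ p)); first by apply: mono; lra.
by rewrite powRM// ler_wpM2l ?powR_ge0// lerDl powR_ge0.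
Qed.

Lemma poweR_add_le (x y : \bar R) (p : R) : (0 <= x)%E -> (0 <= y)%E -> 0 < p ->
  ((x + y) `^ p <= (2 `^ p)%:E * (x `^ p + y `^ p))%E.
Proof.
move=> + + p0; have pn0 : p != 0 by rewrite gt_eqF.
have c0 : 0 < 2 `^ p :> R by rewrite powR_gt0.
move: x y => [x| |] [y| |]//= x0 y0.
- by apply: powR_add_le => //; rewrite -lee_fin.
- by rewrite (negbTE pn0) addey// gt0_muley ?leey// lte_fin.
- by rewrite (negbTE pn0) addye// gt0_muley ?leey// lte_fin.
- by rewrite (negbTE pn0) gt0_muley ?leey// lte_fin.
Qed.

End poweR_bounds.

Section morrey_bounds.
Context {R : realType} {n : nat}.
Local Notation mu := (@lebesgue_n R n).
Variables (v : R) (v0 : 0 < v).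
Hypothesis vE : forall (a : Rn R n) r, 0 < r ->
  mu (eball a r) = (v * r ^+ n)%:E.

Lemma ball_volume_gt0 (r : R) : 0 < r -> 0 < v * r ^+ n.
Proof. by move=> r0; rewrite mulr_gt0// exprn_gt0. Qed.

Lemma gmorrey_normP p phi (f : Rn R n -> \bar R) (N : R) (a : Rn R n) (r : R) :
  0 < p -> 0 < r -> 0 < phi r ->
  (gmorrey_norm p phi f <= N%:E)%E ->
  (\int[mu]_(x in eball a r) (`|f x| `^ p)
   <= ((N * phi r) `^ p * (v * r ^+ n))%:E)%E.
Proof.
move=> p0 r0 ph0 hN; have V0 := ball_volume_gt0 r0.
have i0 : (0 <= \int[mu]_(x in eball a r) (`|f x| `^ p))%E.
  by apply: integral_ge0 => x _; exact: poweR_ge0.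
have := le_trans (ereal_sup_ubound _) hN.
move=> /(_ _ (ex_intro _ a (ex_intro _ r (conj r0 erefl)))).
rewrite vE// inver gt_eqF// => /le_poweR_of_root; rewrite invr_gt0 =>
  /(_ ph0 p0).
rewrite mule_ge0// ?lee_fin ?invr_ge0 ?(ltW V0)// => /(_ isT); rewrite invrK.
by rewrite lee_pdivrMl// -EFinM mulrC.
Qed.

Lemma morrey_normP p q (f : Rn R n -> R) (N : R) (a : Rn R n) (r : R) :
  0 < p -> 0 < r ->
  (morrey_norm p q (EFin \o f) <= N%:E)%E ->
  (\int[mu]_(x in eball a r) (`|f x| `^ p)%:E
   <= ((N * (v * r ^+ n) `^ (p^-1 - q^-1)) `^ p)%:E)%E.
Proof.
move=> p0 r0 hN; have V0 := ball_volume_gt0 r0.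
have iE : (\int[mu]_(x in eball a r) (`|(EFin \o f) x| `^ p) =
    \int[mu]_(x in eball a r) (`|f x| `^ p)%:E)%E.
  by [].
have i0 : (0 <= \int[mu]_(x in eball a r) (`|f x| `^ p)%:E)%E.
  by apply: integral_ge0 => x _; rewrite lee_fin powR_ge0.
have := le_trans (ereal_sup_ubound _) hN.
move=> /(_ _ (ex_intro _ a (ex_intro _ r (conj r0 erefl)))).
rewrite vE// poweR_EFin iE => /le_poweR_of_root; rewrite powR_gt0// =>
  /(_ isT p0 i0).
by rewrite -powRN opprB.
Qed.

(** Hoelder's inequality against the indicator of the ball bounds the mean of [|f|] by its [L^p]
    mean. *)
Lemma integral_abs_ball_le p phi (f : Rn R n ->
  R) (N : R) (a : Rn R n) (r : R) :
  1 <= p -> 0 < r -> 0 < phi r -> 0 <= N -> measurable_fun setT f ->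
  (gmorrey_norm p phi (EFin \o f) <= N%:E)%E ->
  (\int[mu]_(x in eball a r) (`|f x|)%:E <= (N * phi r * (v * r ^+ n))%:E)%E.
Proof.
move=> p1 r0 ph0 N0 mf hN; have V0 := ball_volume_gt0 r0.
have p0 : 0 < p by exact: lt_le_trans p1.
have := gmorrey_normP a p0 r0 ph0 hN; set B := eball a r => hB.
have mB : measurable B := measurable_eball _ _.
have mnf : measurable_fun setT (fun x => `|f x|) by exact: measurableT_comp.
pose F x := `|f x| `^ p * \1_B x; pose G (x : Rn R n) : R := \1_B x.
have mF : measurable_fun setT F.
  by apply: measurable_funM; [exact: measurable_powR_fun|exact:
    measurable_indic].
have mG : measurable_fun setT G by exact: measurable_indic.
have F0 x : 0 <= F x by rewrite mulr_ge0 ?powR_ge0.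
have G0 x : 0 <= G x by [].
have p01 : 0 <= p^-1 <= 1 by rewrite invr_ge0 (ltW p0)/= invf_le1.
have := integral_powR_mul mu mF mG F0 G0 p01.
have -> : (\int[mu]_x (F x `^ p^-1 * G x `^ (1 - p^-1))%:E = \int[mu]_(x in B)
  (`|f x|)%:E)%E.
  rewrite [RHS]integral_mkcond; apply: eq_integral => x _;
    rewrite /patch /F /G indicE.
  case: ifPn => xB; last by rewrite mulr0 powR0 ?mul0r// gt_eqF// invr_gt0.
  by rewrite mulr1 -powRrM mulfV ?gt_eqF// powRr1// powR1 mulr1.
have -> : (\int[mu]_x (F x)%:E = \int[mu]_(x in B) (`|f x| `^ p)%:E)%E.
  rewrite [RHS]integral_mkcond; apply: eq_integral => x _;
    rewrite /patch /F indicE.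
  by case: ifPn => xB; rewrite ?mulr1 ?mulr0.
have -> : (\int[mu]_x (G x)%:E = (v * r ^+ n)%:E)%E.
  by rewrite /G integral_indic// setIT; exact: vE.
move=> /le_trans; apply.
have -> : N * phi r * (v * r ^+ n) =
    ((N * phi r) `^ p * (v * r ^+ n)) `^ p^-1 * (v * r ^+ n) `^ (1 - p^-1).
  rewrite powRM ?powR_ge0 ?(ltW V0)// -powRrM mulfV ?gt_eqF// powRr1; last
    by rewrite mulr_ge0// ltW.
  by rewrite -[RHS]mulrA -powRD ?subrKC ?powRr1 ?(ltW V0)// oner_eq0.
rewrite [leRHS]EFinM poweR_EFin; apply: lee_wpmul2r; first
  by rewrite lee_fin powR_ge0.
rewrite -poweR_EFin; apply: gt0_ler_poweR => //; first by rewrite invr_ge0 ltW.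
  by rewrite in_itv/= leey andbT integral_ge0// => x _;
    rewrite lee_fin powR_ge0.
by rewrite in_itv/= leey andbT lee_fin mulr_ge0 ?powR_ge0// ltW.
Qed.

End morrey_bounds.

(** * Upper bound *)

Section upper_bound.
Context {R : realType} {n : nat}.
Hypothesis n_gt0 : (0 < n)%N.
Local Notation mu := (@lebesgue_n R n).
Variables (v : R) (v0 : 0 < v).
Hypothesis vE : forall (a : Rn R n) r, 0 < r ->
  mu (eball a r) = (v * r ^+ n)%:E.
Variables (alpha gamma : R).
Hypotheses (alpha_lt : alpha < n%:R) (gamma_ge0 : 0 <= gamma).
Local Notation K := (@bessel_riesz_kernel R n alpha gamma).
Variables (s t t' N : R).
Hypotheses (s1 : 1 < s) (t_gt0 : 0 < t) (tt' : t^-1 + t'^-1 = 1) (N0 : 0 <= N).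
Hypothesis KN : (morrey_norm s t (EFin \o K) <= N%:E)%E.

Let s0 : 0 < s. Proof. exact: lt_trans s1. Qed.

(** The Morrey norm is tested on the centred ball of radius [|x|], where the kernel is at least
    [K x] off the origin. The power [1/s] of the volume cancels and leaves the power [-1/t]. *)
Lemma kernel_decay (x : Rn R n) : 0 < enorm x ->
  K x <= N * v `^ (- t^-1) * enorm x `^ (- (n%:R / t)).
Proof.
move=> x0; pose r := enorm x; have V0 := ball_volume_gt0 (n := n) v0 x0.
have K0 := @bessel_riesz_kernel_ge0 R n alpha gamma.
have h1 := morrey_normP v0 vE (torigin n) s0 x0 KN.
have h2 : ((K x `^ s * (v * r ^+ n))%:E
    <= \int[mu]_(y in eball (torigin n) r) (`|K y| `^ s)%:E)%E.
  apply: ge_integral_centered_ball => //.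
  - exact: powR_ge0.
  - exact: vE.
  move=> y /andP[y0 yr]; rewrite lee_fin (ger0_norm (K0 y)).
  apply: ge0_ler_powR; rewrite ?nnegrE ?K0 ?(ltW s0)//.
  by apply: bessel_riesz_kernel_le => //; exact: ltW.
have : K x `^ s * (v * r ^+ n) <= (N * (v * r ^+ n) `^ (s^-1 - t^-1)) `^ s.
  by rewrite -lee_fin; exact: le_trans h1.
have -> : K x `^ s * (v * r ^+ n) = (K x * (v * r ^+ n) `^ s^-1) `^ s.
  by rewrite powRM ?powR_ge0// -powRrM mulVf ?gt_eqF// powRr1// ltW.
move=> h.
have : K x * (v * r ^+ n) `^ s^-1 <= N * (v * r ^+ n) `^ (s^-1 - t^-1).
  rewrite leNgt; apply/negP => lt; move: h; rewrite leNgt => /negP; apply.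
  by apply: gt0_ltr_powR; rewrite ?nnegrE// mulr_ge0 ?powR_ge0.
rewrite powRD ?(gt_eqF V0) ?implybT// mulrCA (mulrC (K x)) ler_pM2l ?powR_gt0//.
move=> /le_trans; apply; rewrite powRM ?exprn_ge0 ?(ltW x0)// ?(ltW v0)//.
by rewrite -powR_mulrn ?(ltW x0)// -powRrM mulrN mulrA.
Qed.

Variables (phi g : R -> R) (c C1 : R).
Hypotheses (phi_gt0 : pos_fun phi) (c0 : 0 < c).
Hypothesis mg : measurable_fun setT g.
Hypothesis g0 : forall r, 0 <= g r.
Hypothesis phig : forall r, 0 < r -> c * phi r <= g r <= phi r.
Hypothesis phi_tail : forall rho : R, 0 < rho ->
  (\int[lebesgue_measure]_(r in `[rho, +oo[) (phi r * r `^ (n%:R / t' - 1))%:E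
   <= (C1 * phi rho * rho `^ (n%:R / t'))%:E)%E.
Variables (p1 F : R) (f : Rn R n -> R).
Hypotheses (p1_ge1 : 1 <= p1) (F0 : 0 <= F) (mf : measurable_fun setT f).
Hypothesis fF : (gmorrey_norm p1 phi (EFin \o f) <= F%:E)%E.

(** In the constant, [v^(-1/t)] stems from the kernel decay, [2^(n/t + 1)] from the tail integral,
    [v] from the ball volumes, [C1] from (i), and [1/c] from passing to [g]. *)
Lemma far_part_le (x : Rn R n) (rho : R) : 0 < rho ->
  (\int[mu]_(y in ~` eball x rho) (K (tsub x y) * `|f y|)%:E
   <= (v `^ (- t^-1) * 2 `^ (n%:R / t + 1) * v * C1 / c * N * F
       * (phi rho * rho `^ (n%:R / t')))%:E)%E.
Proof.
move=> rho0; pose a := n%:R / t.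
have nn : 0 < n%:R :> R by rewrite ltr0n.
have a0 : 0 < a by rewrite divr_gt0.
have mnf : measurable_fun setT (fun y => `|f y|) by exact: measurableT_comp.
pose M := N * v `^ (- t^-1).
have M0 : 0 <= M by rewrite mulr_ge0 ?powR_ge0.
apply: (@le_trans _ _ (\int[mu]_(y in ~` eball x rho)
    (M%:E * (enorm (tsub x y) `^ (- a) * `|f y|)%:E))%E).
  apply: le_integral_nonneg => y; rewrite /eball/= enorm_tsubC => /negP;
    rewrite -leNgt => xy.
    by rewrite lee_fin mulr_ge0 ?bessel_riesz_kernel_ge0.
  rewrite -EFinM lee_fin mulrA; apply: ler_wpM2r => //.
  by apply: kernel_decay; exact: lt_le_trans xy.
rewrite ge0_integralZl//; last 3 first.
- exact: measurableC (measurable_eball _ _).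
- apply: measurable_funTS; apply/measurable_EFinP; apply: measurable_funM => //.
  apply: measurable_powR_fun; apply: (measurableT_comp (@measurable_enorm R n)).
  exact: measurable_tsubr.
- by move=> y _; rewrite lee_fin mulr_ge0 ?powR_ge0.
have h := integral_tail_le x a0 rho0 mnf (fun y => normr_ge0 (f y)).
apply: (@le_trans _ _ (M%:E * ((2 `^ (a + 1))%:E * ((F * v / c)%:E *
    (C1 * phi rho * rho `^ (n%:R / t'))%:E)))%E); last first.
  by rewrite -!EFinM lee_fin /M le_eqVlt; apply/orP; left; apply/eqP; ring.
apply: lee_wpmul2l; first by rewrite lee_fin.
apply: (le_trans h); apply: lee_wpmul2l; first by rewrite lee_fin powR_ge0.
have Fvc : 0 <= F * v / c by rewrite !mulr_ge0 ?invr_ge0// ltW.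
(* Here [phi] is replaced by [g / c], so that the constant can leave the integral; [g <= phi] then
   leads back to (i). *)
apply: (@le_trans _ _ (\int[lebesgue_measure]_(r in `[rho, +oo[)
    ((F * v / c)%:E * (g r * r `^ (n%:R / t' - 1))%:E))%E).
  apply: le_integral_nonneg => r; rewrite /= in_itv/= andbT => rr.
    by rewrite mule_ge0 ?lee_fin ?powR_ge0// integral_ge0// => y _;
      rewrite lee_fin.
  have r0 := lt_le_trans rho0 rr.
  have := integral_abs_ball_le v0 vE x p1_ge1 r0 (phi_gt0 r0) F0 mf fF.
  move=> /(lee_wpmul2l _)-/(_ (r `^ (- a - 1))%:E); rewrite lee_fin powR_ge0 =>
    /(_ isT)/le_trans; apply.
  rewrite -!EFinM lee_fin.
  have -> : n%:R / t' - 1 = n%:R + (- a - 1).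
    have -> : t'^-1 = 1 - t^-1 by rewrite -tt' addrAC subrr add0r.
    by rewrite /a; ring.
  have -> : r `^ (n%:R + (- a - 1)) = r ^+ n * r `^ (- a - 1).
    by rewrite powRD ?(gt_eqF r0) ?implybT// powR_mulrn ?(ltW r0).
  have -> : r `^ (- a - 1) * (F * phi r * (v * r ^+ n)) =
     F * v * (r ^+ n * r `^ (- a - 1)) * phi r by ring.
  have -> : F * v / c * (g r * (r ^+ n * r `^ (- a - 1))) =
     F * v * (r ^+ n * r `^ (- a - 1)) * (g r / c) by ring.
  apply: ler_wpM2l; first by rewrite !mulr_ge0 ?powR_ge0 ?exprn_ge0// ltW.
  by rewrite ler_pdivlMr// mulrC; case/andP: (phig r0).
rewrite ge0_integralZl//; last 2 first.
- apply: measurable_funTS; apply/measurable_EFinP.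
  by apply: measurable_funM => //; exact: measurable_powR.
- by move=> r _; rewrite lee_fin mulr_ge0 ?powR_ge0.
apply: lee_wpmul2l; first by rewrite lee_fin.
apply: le_trans (phi_tail rho0); apply: le_integral_nonneg => r.
  by move=> _; rewrite lee_fin mulr_ge0 ?powR_ge0.
rewrite /= in_itv/= andbT => rr; rewrite lee_fin ler_wpM2r ?powR_ge0//.
by case/andP: (phig (lt_le_trans rho0 rr)).
Qed.

Variable (p2 : R).
Hypotheses (p2_gt0 : 0 < p2) (spq : s^-1 + p1^-1 = 1 + p2^-1).
Hypothesis phi2 : forall r, 0 < r -> c * phi (2 * r) <= phi r.

Definition near_part (a : Rn R n) (rho : R) (x : Rn R n) : \bar R :=
  (\int[mu]_y ((K (tsub x y) * \1_(eball (torigin n) rho) (tsub x y)) *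
               (`|f y| * \1_(eball a (2 * rho)) y))%:E)%E.

Lemma near_part_ge0 a rho x : (0 <= near_part a rho x)%E.
Proof.
apply: integral_ge0 => y _.
by rewrite lee_fin mulr_ge0// mulr_ge0// bessel_riesz_kernel_ge0.
Qed.

(** The volume exponents balance as [1/s - 1/t + 1/p1 = 1/t' + 1/p2]: the term [1/t'] gives
    [rho^(n/t')] and [v^(1/t')], the term [1/p2] the volume factor. The doubled radius costs
    [2^(n/p1)], and [1/c] compares [phi (2 * rho)] with [phi rho]. *)
Lemma integral_near_part_le (a : Rn R n) (rho : R) : 0 < rho ->
  (\int[mu]_x (near_part a rho x) `^ p2
   <= ((v `^ t'^-1 * 2 `^ (n%:R / p1) / c * N * F * (phi rho * rho `^ (n%:R /
     t')))
       `^ p2 * (v * rho ^+ n))%:E)%E.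
Proof.
move=> rho0; have V0 := ball_volume_gt0 (n := n) v0 rho0.
have p10 : 0 < p1 by exact: lt_le_trans p1_ge1.
have r20 : 0 < 2 * rho by rewrite mulr_gt0.
set V := v * rho ^+ n in V0 *.
have mnf : measurable_fun setT (fun y => `|f y|) by exact: measurableT_comp.
pose k x := K x * \1_(eball (torigin n) rho) x.
pose h y := `|f y| * \1_(eball a (2 * rho)) y.
have mk : measurable_fun setT k.
  apply: measurable_funM; first exact: measurable_bessel_riesz_kernel.
  by apply: measurable_indic; exact: measurable_eball.
have mh : measurable_fun setT h.
  by apply: measurable_funM => //; apply: measurable_indic;
    exact: measurable_eball.
have k0 x : 0 <= k x by rewrite mulr_ge0 ?bessel_riesz_kernel_ge0.
have h0 x : 0 <= h x by rewrite mulr_ge0.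
pose A := (N * V `^ (s^-1 - t^-1)) `^ s.
pose G := (F * phi (2 * rho)) `^ p1 * (v * (2 * rho) ^+ n).
have kA : (\int[mu]_x (k x `^ s)%:E <= A%:E)%E.
  apply: le_trans (morrey_normP v0 vE (torigin n) s0 rho0 KN).
  rewrite [leRHS]integral_mkcond; apply: le_integral_nonneg => x _.
    by rewrite lee_fin powR_ge0.
  rewrite /patch /k indicE; case: ifPn => xB; last
    by rewrite mulr0 powR0 ?gt_eqF.
  by rewrite mulr1 ger0_norm// bessel_riesz_kernel_ge0.
have hG : (\int[mu]_x (h x `^ p1)%:E <= G%:E)%E.
  apply: le_trans (gmorrey_normP v0 vE a p10 r20 (phi_gt0 r20) fF).
  rewrite [leRHS]integral_mkcond; apply: le_integral_nonneg => x _.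
    by rewrite lee_fin powR_ge0.
  rewrite /patch /h indicE; case: ifPn => xB; last
    by rewrite mulr0 powR0 ?gt_eqF.
  by rewrite mulr1.
have G0 : 0 <= G by rewrite mulr_ge0 ?powR_ge0// ltW// ball_volume_gt0.
apply: le_trans (young_convolution mk mh k0 h0 s1 p1_ge1 p2_gt0 spq (powR_ge0 _
  _) G0 kA hG) _.
have FV : 0 <= F * phi (2 * rho) by rewrite mulr_ge0// ltW// phi_gt0.
have AE : A `^ (p2 / s) = (N * V `^ (s^-1 - t^-1)) `^ p2.
  by rewrite /A -powRrM mulrCA mulfV ?gt_eqF// mulr1.
have GE : G `^ (p2 / p1) = (F * phi (2 * rho) * (2 `^ (n%:R / p1) * V `^
  p1^-1)) `^ p2.
  rewrite mulrC powRrM /G; congr (_ `^ p2).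
  rewrite powRM ?powR_ge0//; last by rewrite ltW// ball_volume_gt0.
  rewrite -powRrM mulfV ?gt_eqF// powRr1//; congr (_ * _).
  rewrite exprMn mulrCA powRM ?exprn_ge0// ?(ltW V0)//; congr (_ * _).
  by rewrite -powR_mulrn// -powRrM.
set D := v `^ _ * _ / c * N * F * _.
have D0 : 0 <= D.
  have phi0 : 0 <= phi rho by exact/ltW/phi_gt0.
  have c1 : 0 <= c^-1 by rewrite invr_ge0 ltW.
  by rewrite /D; nonneg.
have DV : D `^ p2 * V = (D * V `^ p2^-1) `^ p2.
  by rewrite powRM ?powR_ge0// -powRrM mulVf ?gt_eqF// powRr1// ltW.
rewrite lee_fin AE GE DV -powRM; last 2 first.
- by nonneg.
- by nonneg.
apply: ge0_ler_powR; rewrite ?nnegrE ?(ltW p2_gt0)//.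
- by nonneg.
- by nonneg.
have e1 : V `^ (s^-1 - t^-1) * V `^ p1^-1 = V `^ t'^-1 * V `^ p2^-1.
  rewrite -!powRD ?(gt_eqF V0) ?implybT//; congr (_ `^ _).
  have -> : t'^-1 = 1 - t^-1 by rewrite -tt' addrAC subrr add0r.
  by rewrite addrAC spq; ring.
have e2 : V `^ t'^-1 = v `^ t'^-1 * rho `^ (n%:R / t').
  by rewrite powRM ?exprn_ge0 ?(ltW v0) ?(ltW rho0)// -powR_mulrn ?(ltW rho0)//
    -powRrM.
have -> : N * V `^ (s^-1 - t^-1) * (F * phi (2 * rho) * (2 `^ (n%:R / p1) * V
  `^ p1^-1))
   = N * F * 2 `^ (n%:R / p1) * (V `^ (s^-1 - t^-1) * V `^ p1^-1) * phi (2 *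
     rho) by ring.
rewrite e1 e2.
have -> : D * V `^ p2^-1
  = N * F * 2 `^ (n%:R / p1) * (v `^ t'^-1 * rho `^ (n%:R / t') * V `^ p2^-1) *
    (phi rho / c) by rewrite /D; ring.
apply: ler_wpM2l; first by nonneg.
by rewrite ler_pdivlMr// mulrC phi2.
Qed.

Lemma abs_bessel_riesz_le (a x : Rn R n) (rho : R) : eball a rho x ->
  (`|bessel_riesz alpha gamma f x| <= near_part a rho x +
     \int[mu]_(y in ~` eball x rho) (K (tsub x y) * `|f y|)%:E)%E.
Proof.
move=> xa.
have mnf : measurable_fun setT (fun y => `|f y|) by exact: measurableT_comp.
have mKx : measurable_fun setT (fun y => K (tsub x y)).
  exact: (measurableT_comp (@measurable_bessel_riesz_kernel R n alpha gamma)
    (@measurable_tsubr R n x)).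
have mB := @measurable_eball R n.
apply: (@le_trans _ _ (\int[mu]_y (K (tsub x y) * `|f y|)%:E)%E).
  apply: le_trans (le_abse_integral _ _ _) _ => //.
    by apply/measurable_EFinP; exact: measurable_funM.
  apply: le_integral_nonneg => y _ //.
  by rewrite /= lee_fin normrM ger0_norm// bessel_riesz_kernel_ge0.
rewrite -(setUv (eball x rho)) ge0_integral_setU//; last 4 first.
- exact: measurableC.
- by rewrite setUv; apply/measurable_EFinP; exact: measurable_funM.
- by move=> y _; rewrite lee_fin mulr_ge0 ?bessel_riesz_kernel_ge0.
- by rewrite disj_set2E setICr.
apply: leeD => //; rewrite [leLHS]integral_mkcond.
apply: le_integral_nonneg => y _; rewrite /patch; case: ifPn =>
  [/set_mem xy|_] //.
- by rewrite lee_fin mulr_ge0 ?bessel_riesz_kernel_ge0.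
- rewrite lee_fin !indicE !mem_set ?mulr1//.
    rewrite /eball/= in xa xy *.
    apply: le_lt_trans (enorm_sub_triangle y x a) _.
    by have := ltrD xy xa; rewrite mulr_natl mulr2n.
  by move: xy; rewrite /eball/= tsub0r enorm_tsubC.
- by rewrite lee_fin mulr_ge0// mulr_ge0// bessel_riesz_kernel_ge0.
Qed.

End upper_bound.

Section upper_bound_assembly.
Context {R : realType} {n : nat}.
Local Notation mu := (@lebesgue_n R n).

(** This permits the division in [op_norm]. A zero norm would make the integral of [|f|] vanish on
    the balls of radius [k + 1], which exhaust the space. *)
Lemma gmorrey_norm_gt0 p phi (f : Rn R n -> R) : 1 <= p -> pos_fun phi ->
  measurable_fun setT f -> ~ {ae mu, forall x, f x = 0} ->
  (0 < gmorrey_norm p phi (EFin \o f))%E.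
Proof.
move=> p1 ph0 mf f_neq0; have [v v0 vE] := @lebesgue_n_ball R n.
rewrite ltNge; apply/negP => h; apply: f_neq0.
pose B k := eball (torigin n : Rn R n) k.+1%:R.
have mB k : measurable (B k) := measurable_eball _ _.
have fB k : {ae mu, forall x, B k x -> (f x)%:E = 0%E}.
  have k0 : 0 < k.+1%:R :> R by [].
  have := integral_abs_ball_le v0 vE (torigin n) p1 k0 (ph0 _ k0) (lexx 0) mf h.
  rewrite !mul0r => fk.
  apply: (ae_eq_integral_abs mu (mB k) (f := EFin \o f) _).1.
    by apply: measurable_funTS; exact/measurable_EFinP.
  by apply/eqP; rewrite eq_le fk/= integral_ge0// => x _; rewrite lee_fin.
have := ae_foralln fB; apply: filterS => x fx.
have [k xk] : exists k, B k x.
  exists (Num.truncn (enorm x)); rewrite /B /eball/= tsub0r.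
  exact: truncnS_gt.
by have := fx k xk => -[].
Qed.

(** The constant is chosen before [alpha] and [gamma], whose whole influence sits in the Morrey norm
    of the kernel. *)
Lemma op_norm_bessel_riesz_le (phi : R -> R) (p1 p2 s t t' : R) : (0 < n)%N ->
  1 <= p1 -> 1 < s -> 0 < t -> t^-1 + t'^-1 = 1 -> 0 < p2 ->
  s^-1 + p1^-1 = 1 + p2^-1 -> pos_fun phi -> almost_decreasing phi ->
  (exists2 C1 : R, 0 < C1 & forall rho : R, 0 < rho ->
    (\int[lebesgue_measure]_(r in `[rho, +oo[)
       (phi r * r `^ (n%:R / t' - 1))%:E
     <= (C1 * phi rho * rho `^ (n%:R / t'))%:E)%E) ->
  exists2 C : R, 0 < C & forall alpha gamma : R, alpha < n%:R -> 0 <= gamma ->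
  (@op_norm R n (gmorrey p1 phi) (gmorrey_norm p1 phi)
     (gmorrey_norm p2 (fun r => (phi r * r `^ (n%:R / t'))%R)) (bessel_riesz
       alpha gamma)
   <= C%:E * @morrey_norm R n s t (EFin \o bessel_riesz_kernel alpha gamma))%E.
Proof.
move=> n0 p1_ge1 s1 t0 tt' p2_gt0 spq phi_gt0 phi_dec [C1 C1_gt0 phi_tail].
have [v v0 vE] := @lebesgue_n_ball R n.
have [g [c c0 [mg _ g0 gmono phig]]] := almost_decreasing_minorant phi_gt0
  phi_dec.
have phi2 r : 0 < r -> c * phi (2 * r) <= phi r.
  move=> r0; have r20 : 0 < 2 * r by rewrite mulr_gt0.
  have /andP[h _] := phig _ r20; have /andP[_ h'] := phig _ r0.
  apply: le_trans h (le_trans _ h'); apply: gmono => //.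
  by rewrite ler_peMl ?ler1n// ltW.
pose D1 := v `^ t'^-1 * 2 `^ (n%:R / p1) / c.
pose D2 := v `^ (- t^-1) * 2 `^ (n%:R / t + 1) * v * C1 / c.
have D10 : 0 < D1 by rewrite !mulr_gt0 ?powR_gt0 ?invr_gt0.
have D20 : 0 < D2 by rewrite !mulr_gt0 ?powR_gt0 ?invr_gt0.
have p2n : p2 != 0 by rewrite gt_eqF.
(* [D1] and [D2] are the near and far constants. The factor 2 pays for the power of a sum, and
   [2^(1/p2)] for bounding [E1^p2 + E2^p2] by [2 (E1 + E2)^p2]. *)
exists (2 * 2 `^ p2^-1 * (D1 + D2)).
  by rewrite !mulr_gt0 ?powR_gt0// addr_gt0.
move=> alpha gamma alpha_lt gamma0.
set K := @bessel_riesz_kernel R n alpha gamma.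
have C0 : 0 < 2 * 2 `^ p2^-1 * (D1 + D2).
  by rewrite !mulr_gt0 ?powR_gt0// addr_gt0.
have N0 : (0 <= morrey_norm s t (EFin \o K))%E.
  apply: le_trans (ereal_sup_ubound _); last first.
    by exists (torigin n), 1; split; [exact: ltr01|reflexivity].
  by rewrite mule_ge0 ?poweR_ge0.
(* If the kernel norm is infinite, so is the right-hand side, the constant being positive. *)
have [NE|] := eqVneq (morrey_norm s t (EFin \o K)) +oo%E.
  by rewrite NE gt0_muley ?leey// lte_fin.
rewrite -ltey => Nlt.
have : morrey_norm s t (EFin \o K) \is a fin_num by rewrite ge0_fin_numE.
move=> /fineK NE; rewrite -NE; set N := fine _ in NE *.
have {}N0 : 0 <= N by rewrite -lee_fin NE.
have KN : (morrey_norm s t (EFin \o K) <= N%:E)%E by rewrite NE.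
apply: ge_ereal_sup => _ [f [[[mf floc] fF] f_neq0] ->].
have F0 := gmorrey_norm_gt0 p1_ge1 phi_gt0 mf f_neq0.
have : gmorrey_norm p1 phi (EFin \o f) \is a fin_num
  by rewrite ge0_fin_numE ?(ltW F0).
move=> /fineK FE; rewrite -FE; set F := fine _ in FE *.
have {}F0 : 0 < F by rewrite -lte_fin FE.
have {}fF : (gmorrey_norm p1 phi (EFin \o f) <= F%:E)%E by rewrite FE.
rewrite inver gt_eqF// lee_pdivrMr// -EFinM.
apply: ge_ereal_sup => _ [a [rho [rho0 ->]]].
have phi0 := phi_gt0 _ rho0.
set psi := phi rho * rho `^ (n%:R / t').
have psi0 : 0 < psi by rewrite mulr_gt0 ?powR_gt0.
pose V := v * rho ^+ n; have V0 : 0 < V := ball_volume_gt0 v0 rho0.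
rewrite vE// -/V inver gt_eqF//.
rewrite lee_pdivrMl// -EFinM.
pose E1 := D1 * N * F * psi; pose E2 := D2 * N * F * psi.
have E10 : 0 <= E1 by rewrite /E1; nonneg.
have E20 : 0 <= E2 by rewrite /E2; nonneg.
have -> : psi * (2 * 2 `^ p2^-1 * (D1 + D2) * N * F) = 2 * 2 `^ p2^-1 * (E1 +
  E2).
  by rewrite /E1 /E2; ring.
apply: root_le_of_poweR => //.
- by rewrite mule_ge0 ?lee_fin ?invr_ge0 ?(ltW V0)// integral_ge0// => x _;
  exact: poweR_ge0.
- by rewrite !mulr_ge0 ?powR_ge0// addr_ge0.
rewrite lee_pdivrMl//.
have F0' := ltW F0.
have far x := far_part_le n0 v0 vE alpha_lt gamma0 s1 t0 tt' N0 KN phi_gt0 c0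
  mg g0 phig phi_tail p1_ge1 F0' mf fF x rho0.
have near := integral_near_part_le v0 vE s1 tt' N0 KN phi_gt0 c0
  p1_ge1 F0' mf fF p2_gt0 spq phi2 a rho0.
have mB : measurable (eball a rho) := measurable_eball _ _.
pose np := near_part alpha gamma f a rho.
have np0 x : (0 <= np x)%E by exact: near_part_ge0.
have mnp : measurable_fun setT (fun x => np x `^ p2)%E.
  apply: (measurableT_comp (measurable_poweR p2)).
  pose H (z : Rn R n * Rn R n) := ((K (tsub z.1 z.2) * \1_(eball (torigin n)
    rho) (tsub z.1 z.2)) *
               (`|f z.2| * \1_(eball a (2 * rho)) z.2))%:E.
  have H0 z : (0 <= H z)%E.
    by rewrite lee_fin mulr_ge0// mulr_ge0// bessel_riesz_kernel_ge0.
  have mH : measurable_fun setT H.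
    apply/measurable_EFinP; apply: measurable_funM.
      have mk : measurable_fun setT (fun x =>
        K x * \1_(eball (torigin n) rho) x).
        apply: measurable_funM; first exact: measurable_bessel_riesz_kernel.
        by apply: measurable_indic; exact: measurable_eball.
      exact: (measurableT_comp mk (@measurable_tsub R n)).
    have mh : measurable_fun setT (fun x => `|f x| * \1_(eball a (2 * rho)) x).
      apply: measurable_funM; first exact: measurableT_comp.
      by apply: measurable_indic; exact: measurable_eball.
    exact: (measurableT_comp mh measurable_snd).
  exact: (@measurable_fun_fubini_tonelli_F _ _ _ _ R mu H mH H0).
(* The far part is at most [E2] at every point of the ball, while the near part is controlled only
   in [L^p2] mean. *)
apply: (@le_trans _ _ (\int[mu]_(x in eball a rho)
   ((2 `^ p2)%:E * (np x `^ p2 + (E2 `^ p2)%:E)))%E).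
  apply: le_integral_nonneg => x xB; first exact: poweR_ge0.
  have xle := abs_bessel_riesz_le alpha gamma mf xB.
  apply: (@le_trans _ _ ((np x + E2%:E) `^ p2)%E).
    apply: gt0_ler_poweR; rewrite ?(ltW p2_gt0)// ?in_itv/= ?leey ?andbT//.
    - by rewrite adde_ge0// lee_fin.
    - by apply: (le_trans xle); apply: leeD => //; exact: far.
  by rewrite -poweR_EFin; apply: poweR_add_le => //; rewrite lee_fin.
rewrite ge0_integralZl//; last 2 first.
- by apply: measurable_funTS; apply: emeasurable_funD.
- by move=> x _; rewrite adde_ge0 ?poweR_ge0// lee_fin powR_ge0.
rewrite ge0_integralD//; last first.
- by move=> x _; rewrite lee_fin powR_ge0.
- exact: measurable_funTS.
- by move=> x _; exact: poweR_ge0.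
apply: (@le_trans _ _ ((2 `^ p2)%:E * ((E1 `^ p2 * V)%:E + (E2 `^ p2)%:E *
  V%:E))%E).
  apply: lee_wpmul2l; first by rewrite lee_fin powR_ge0.
  apply: leeD.
    apply: le_trans near; rewrite integral_mkcond; apply: le_integral_nonneg =>
      x _.
      by rewrite /patch; case: ifPn => // _; exact: poweR_ge0.
    by rewrite /patch; case: ifPn => // _; exact: poweR_ge0.
  rewrite /V -(vE a rho rho0); apply: integral_le_cst => // x _.
  by rewrite lee_fin powR_ge0.
have -> : ((2 `^ p2)%:E * ((E1 `^ p2 * V)%:E + (E2 `^ p2)%:E * V%:E))%E =
  (2 `^ p2 * (E1 `^ p2 * V + E2 `^ p2 * V))%:E by [].
rewrite -EFinM lee_fin -mulrDl mulrA mulrC ler_pM2l//.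
have E120 : 0 <= E1 + E2 by rewrite addr_ge0.
have -> : (2 * 2 `^ p2^-1 * (E1 + E2)) `^ p2 = 2 `^ p2 * 2 * (E1 + E2) `^ p2.
  rewrite powRM//.
  by rewrite powRM// -powRrM mulVf// powRr1.
rewrite -mulrA; apply: ler_wpM2l; first exact: powR_ge0.
have mono (x : R) : 0 <= x -> x <= E1 + E2 -> x `^ p2 <= (E1 + E2) `^ p2.
  by move=> x0 xE; apply: ge0_ler_powR; rewrite ?nnegrE ?(ltW p2_gt0)//
    addr_ge0.
have h1 : E1 `^ p2 <= (E1 + E2) `^ p2 by apply: mono => //; rewrite lerDl.
have h2 : E2 `^ p2 <= (E1 + E2) `^ p2 by apply: mono => //; rewrite lerDr.
by lra.
Qed.

End upper_bound_assembly.

(** * Lower bound *)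

Section geometry.
Context {R : realType} {n : nat}.

Lemma enorm_scale (c : R) (x : Rn R n) :
  enorm (taffine c (torigin n) x) = `|c| * enorm x.
Proof.
have -> : taffine c (torigin n) x = tsub (taffine c (torigin n) x) (taffine c
  (torigin n) (torigin n)).
  by apply: eq_from_tnth => i; rewrite !tnth_mktuple; ring.
by rewrite enorm_taffine tsub0r.
Qed.

(** With the next lemma this gives a dichotomy for radially decreasing functions: a ball lies in the
    centred ball of triple radius, or it stays at distance more than [r] from the origin, where the
    value at [r] is an upper bound. *)
Lemma eball_sub_centered (a : Rn R n) (r : R) : enorm a < 2 * r ->
  eball a r `<=` eball (torigin n) (3 * r).
Proof.
move=> ar x; rewrite /eball/= => xa; rewrite tsub0r.
have := enorm_sub_triangle x a (torigin n); rewrite !tsub0r; lra.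
Qed.

Lemma enorm_ge_far (a x : Rn R n) (r : R) : 2 * r <= enorm a -> eball a r x ->
  r < enorm x.
Proof.
move=> ar; rewrite /eball/= enorm_tsubC => xa.
have := enorm_sub_triangle a x (torigin n); rewrite !tsub0r; lra.
Qed.

(* The ball whose diameter is the segment from the origin to [x]. *)
Lemma half_ball_bounds (x y : Rn R n) :
  eball (taffine 2^-1 (torigin n) x) (enorm x / 2) y ->
  [/\ 0 < enorm y, enorm y <= enorm x, 0 < enorm (tsub x y) &
      enorm (tsub x y) <= enorm x].
Proof.
set h := taffine _ _ x; rewrite /eball/= => yh.
have hE : enorm h = enorm x / 2.
  by rewrite enorm_scale ger0_norm ?invr_ge0// mulrC.
have xh : enorm (tsub x h) = enorm x / 2.
  rewrite -hE; congr enorm; apply: eq_from_tnth => i; rewrite !tnth_mktuple.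
  by field.
have t1 := enorm_sub_triangle y h (torigin n).
have t2 := enorm_sub_triangle h y (torigin n).
have t3 := enorm_sub_triangle x h y.
have t4 := enorm_sub_triangle x y h.
rewrite !tsub0r in t1 t2; rewrite (enorm_tsubC h y) in t2 t3.
by split; lra.
Qed.

End geometry.

Section lower_bound.
Context {R : realType} {n : nat}.
Hypothesis n_gt0 : (0 < n)%N.
Local Notation mu := (@lebesgue_n R n).
Variables (v : R) (v0 : 0 < v).
Hypothesis vE : forall (a : Rn R n) r, 0 < r ->
  mu (eball a r) = (v * r ^+ n)%:E.
Variable (Cr : R).
Hypothesis Cr0 : 0 < Cr.
Hypothesis radial : forall (h : R -> R) rho,
  0 < rho -> measurable_fun setT h -> h 0 = 0 -> (forall r, 0 <= h r) ->
  (forall r s, 0 < r -> r <= s -> h s <= h r) ->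
  (\int[mu]_(x in eball (torigin n) rho) (h (enorm x))%:E
   <= Cr%:E * \int[lebesgue_measure]_(r in `]0%R,
     rho]) (h r * r `^ (n%:R - 1))%:E)%E.
Variables (phi g : R -> R) (c : R).
Hypotheses (phi_gt0 : pos_fun phi) (c0 : 0 < c).
Hypothesis mg : measurable_fun setT g.
Hypothesis gz : g 0 = 0.
Hypothesis g0 : forall r, 0 <= g r.
Hypothesis gmono : forall r s, 0 < r -> r <= s -> g s <= g r.
Hypothesis phig : forall r, 0 < r -> c * phi r <= g r <= phi r.
Variables (p1 C2 : R).
Hypotheses (p1_ge1 : 1 <= p1) (C2_gt0 : 0 < C2).
Hypothesis phi_head : forall rho : R, 0 < rho ->
  (\int[lebesgue_measure]_(r in `]0%R, rho]) (phi r `^ p1 * r `^ (n%:R - 1))%:E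
   <= (C2 * phi rho `^ p1 * rho ^+ n)%:E)%E.

Let p1_gt0 : 0 < p1. Proof. exact: lt_le_trans p1_ge1. Qed.

Let le_powR (p x y : R) : 0 <= p -> 0 <= x -> x <= y -> x `^ p <= y `^ p.
Proof.
by move=> p0 x0 xy; apply: ge0_ler_powR; rewrite ?nnegrE// (le_trans x0).
Qed.

Definition radial_fun (x : Rn R n) : R := g (enorm x).

Lemma measurable_radial_fun : measurable_fun setT radial_fun.
Proof. exact: (measurableT_comp mg (@measurable_enorm R n)). Qed.

(** An upper bound for the norm of the test function. The 1 accounts for balls away from the origin;
    in the other term [Cr] and [C2] come from the radial integral and (ii), [3 ^+ n] from the
    tripled radius, and the power of [c^-1] from comparing [phi (3 * r)] with [phi r]. *)
Definition radial_norm := (1 + Cr * C2 * 3 ^+ n * (c^-1) `^ p1 / v) `^ p1^-1.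

Lemma radial_norm_gt0 : 0 < radial_norm.
Proof.
by rewrite powR_gt0// ltr_pwDl// !mulr_ge0 ?invr_ge0 ?powR_ge0 ?exprn_ge0// ltW.
Qed.

Lemma integral_radial_fun_le (a : Rn R n) (r : R) : 0 < r ->
  (\int[mu]_(x in eball a r) (`|radial_fun x| `^ p1)%:E
   <= ((radial_norm * phi r) `^ p1 * (v * r ^+ n))%:E)%E.
Proof.
move=> r0; have V0 := ball_volume_gt0 (n := n) v0 r0.
have ph0 := phi_gt0 r0.
have mB := @measurable_eball R n.
set Q := Cr * C2 * 3 ^+ n * (c^-1) `^ p1 / v.
have ci : 0 <= c^-1 by rewrite invr_ge0 ltW.
have vi : 0 <= v^-1 by rewrite invr_ge0 ltW.
have Q0 : 0 <= Q by rewrite /Q; nonneg.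
have -> : (radial_norm * phi r) `^ p1 * (v * r ^+ n) =
    (phi r `^ p1 * (v * r ^+ n)) + Q * phi r `^ p1 * (v * r ^+ n).
  rewrite /radial_norm -/Q powRM ?powR_ge0 ?(ltW ph0)// -powRrM mulVf ?gt_eqF//.
  by rewrite powRr1 ?addr_ge0//; ring.
have p10 := ltW p1_gt0.
have [ar|ar] := leP (2 * r) (enorm a).
  apply: (@le_trans _ _ ((phi r `^ p1)%:E * mu (eball a r))%E); last first.
    by rewrite vE// -EFinM lee_fin lerDl; nonneg.
  apply: integral_le_cst => // x xB.
  have xr := enorm_ge_far ar xB.
  rewrite lee_fin ger0_norm ?g0//; apply: le_powR => //; first exact: g0.
  by apply: le_trans (gmono r0 (ltW xr)) _; case/andP: (phig r0).
have r30 : 0 < 3 * r by rewrite mulr_gt0.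
apply: (@le_trans _ _ (\int[mu]_(x in eball (torigin n) (3 * r)) (g (enorm x)
  `^ p1)%:E)%E).
  rewrite integral_mkcond [leRHS]integral_mkcond; apply: le_integral_nonneg =>
    x _.
    by rewrite /patch; case: ifPn => // _; rewrite lee_fin powR_ge0.
  rewrite /patch; case: ifPn => [/set_mem xB|_].
    rewrite mem_set; last exact: eball_sub_centered xB.
    by rewrite ger0_norm// g0.
  by case: ifPn => // _; rewrite lee_fin powR_ge0.
have hr := @radial (fun r => g r `^ p1) (3 * r) r30.
apply: le_trans (hr _ _ _ _) _.
- exact: measurable_powR_fun.
- by rewrite gz powR0// gt_eqF.
- by move=> ?; exact: powR_ge0.
- by move=> u w u0 uw; apply: le_powR => //; exact: gmono.
apply: (@le_trans _ _ (Cr%:E * (C2 * phi (3 * r) `^ p1 * (3 * r) ^+ n)%:E)%E).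
  apply: lee_wpmul2l; first by rewrite lee_fin ltW.
  apply: le_trans (phi_head r30); apply: le_integral_nonneg => u.
    by rewrite lee_fin mulr_ge0 ?powR_ge0.
  rewrite /= in_itv/= => /andP[u0 _]; rewrite lee_fin ler_wpM2r ?powR_ge0//.
  by apply: le_powR => //; case/andP: (phig u0).
rewrite -EFinM lee_fin; apply: (@le_trans _ _ (Q * phi r `^ p1 * (v * r ^+
  n))); last first.
  by rewrite lerDr; nonneg.
have h3 : phi (3 * r) `^ p1 <= (c^-1) `^ p1 * phi r `^ p1.
  rewrite -powRM ?(ltW ph0)//; apply: le_powR => //; first exact/ltW/phi_gt0.
  rewrite ler_pdivlMl//; have /andP[h _] := phig r30; have /andP[_ h'] :=
    phig r0.
  by apply: le_trans h (le_trans _ h'); apply: gmono => //;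
    rewrite ler_peMl ?ler1n// ltW.
have -> : Q * phi r `^ p1 * (v * r ^+ n) =
   Cr * C2 * 3 ^+ n * r ^+ n * ((c^-1) `^ p1 * phi r `^ p1).
  by rewrite /Q; field; rewrite gt_eqF.
rewrite exprMn.
have -> : Cr * (C2 * phi (3 * r) `^ p1 * (3 ^+ n * r ^+ n)) =
   Cr * C2 * 3 ^+ n * r ^+ n * phi (3 * r) `^ p1 by ring.
by apply: ler_wpM2l => //; nonneg.
Qed.

Lemma gmorrey_norm_radial_fun_le :
  (gmorrey_norm p1 phi (EFin \o radial_fun) <= radial_norm%:E)%E.
Proof.
apply: ge_ereal_sup => _ [a [r [r0 ->]]].
have V0 := ball_volume_gt0 (n := n) v0 r0; have ph0 := phi_gt0 r0.
rewrite vE// inver gt_eqF// lee_pdivrMl// -EFinM.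
apply: root_le_of_poweR => //.
- by rewrite mule_ge0 ?lee_fin ?invr_ge0 ?(ltW V0)// integral_ge0// => x _;
  exact: poweR_ge0.
- by rewrite mulr_ge0 ?(ltW ph0)// ltW// radial_norm_gt0.
rewrite lee_pdivrMl// -EFinM (mulrC (v * _)) (mulrC (phi r)).
exact: integral_radial_fun_le.
Qed.

Lemma gmorrey_radial_fun : gmorrey p1 phi radial_fun.
Proof.
split; last exact: le_lt_trans gmorrey_norm_radial_fun_le (ltry _).
split; first exact: measurable_radial_fun.
by move=> a r r0; apply: le_lt_trans (integral_radial_fun_le a r0) (ltry _).
Qed.

Lemma radial_fun_neq0 : ~ {ae mu, forall x, radial_fun x = 0}.
Proof.
move=> [A [mA A0 hA]].
have mO := @measurable_torigin R n; have mB :=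
  @measurable_eball R n (torigin n) 1.
have : (mu (eball (torigin n) 1) <= mu (A `|` [set torigin n]))%E.
  apply: le_measure; rewrite ?inE//; first exact: measurableU.
  move=> x _; have [->|x0] := eqVneq x (torigin n); [by right|left].
  apply: hA => /=; apply/eqP; rewrite gt_eqF// /radial_fun.
  have {}x0 : 0 < enorm x by rewrite enorm_gt0.
  have /andP[h _] := phig x0; apply: lt_le_trans h.
  by rewrite mulr_gt0// phi_gt0.
move=> /le_trans/(_ (measureU2 _ mA mO)).
have -> : (mu A + mu [set torigin n] = 0)%E.
  by rewrite [X in (X + _)%E]A0 add0e; exact: lebesgue_n_torigin.
by rewrite vE// lee_fin leNgt ball_volume_gt0.
Qed.

Variables (w : R -> R) (cw : R).
Hypothesis cw0 : 0 < cw.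
Hypothesis mw : measurable_fun setT w.
Hypothesis wz : w 0 = 0.
Hypothesis w0 : forall r, 0 <= w r.
Hypothesis wmono : forall r s, 0 < r -> r <= s -> w s <= w r.
Hypothesis phiw : forall r, 0 < r ->
  cw * (phi r * r ^+ n)^-1 <= w r <= (phi r * r ^+ n)^-1.
Variables (s' t t' p2 C3 : R).
Hypotheses (s'_gt0 : 0 < s') (tt' : t^-1 + t'^-1 = 1)
  (p2_gt0 : 0 < p2) (p12 : p2^-1 = p1^-1 - s'^-1) (C3_gt0 : 0 < C3).
Hypothesis phi_dual : forall rho : R, 0 < rho ->
  (\int[lebesgue_measure]_(r in `]0%R, rho])
     (r `^ (n%:R - 1) / (phi r `^ s' * r `^ (n%:R * s')))%:E
   <= (C3 * rho ^+ n / (phi rho `^ s' * rho `^ (n%:R * s')))%:E)%E.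

(** [w] stands for [1/(phi r^n)], so (iii) controls the radial integral of [w^s']. The bound is
    written as an [s']-th power times the volume, the form in which the two Hoelder factors
    combine. *)
Lemma integral_dual_le (rho : R) : 0 < rho ->
  (\int[mu]_(x in eball (torigin n) rho) (w (enorm x) `^ s')%:E
   <= (((Cr * C3 / v) `^ s'^-1 * (phi rho * rho ^+ n)^-1) `^ s' * (v * rho ^+
     n))%:E)%E.
Proof.
move=> rho0; have ph0 := phi_gt0 rho0.
have vi : 0 <= v^-1 by rewrite invr_ge0 ltW.
have dE r : 0 < r -> (phi r `^ s' * r `^ (n%:R * s'))^-1 = ((phi r * r ^+
  n)^-1) `^ s'.
  move=> r0; rewrite -[(phi r * r ^+ n)^-1]powR_inv1 ?mulr_ge0 ?exprn_ge0 ?(ltW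
    r0) ?(ltW (phi_gt0 r0))//.
  rewrite -powRrM mulN1r powRN powRM ?exprn_ge0 ?(ltW r0) ?(ltW (phi_gt0 r0))//.
  by rewrite powRrM powR_mulrn// ltW.
apply: le_trans (@radial (fun r => w r `^ s') rho rho0 _ _ _ _) _.
- exact: measurable_powR_fun.
- by rewrite wz powR0// gt_eqF.
- by move=> ?; exact: powR_ge0.
- by move=> u z u0 uz; apply: le_powR; rewrite ?(ltW s'_gt0)//; exact: wmono.
apply: (@le_trans _ _ (Cr%:E * (C3 * rho ^+ n / (phi rho `^ s' * rho `^ (n%:R *
  s')))%:E)%E).
  apply: lee_wpmul2l; first by rewrite lee_fin ltW.
  apply: le_trans (phi_dual rho0); apply: le_integral_nonneg => u.
    by rewrite lee_fin mulr_ge0 ?powR_ge0.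
  rewrite /= in_itv/= => /andP[u0 _]; rewrite lee_fin mulrC ler_wpM2l
    ?powR_ge0//.
  by rewrite dE//; apply: le_powR; rewrite ?(ltW s'_gt0)//;
    case/andP: (phiw u0).
rewrite dE// -EFinM lee_fin powRM ?powR_ge0//; last first.
  by rewrite invr_ge0 mulr_ge0 ?exprn_ge0// ltW.
rewrite -powRrM mulVf ?gt_eqF// powRr1; last by nonneg.
by rewrite le_eqVlt; apply/orP; left; apply/eqP; field; rewrite gt_eqF.
Qed.

Variables (alpha gamma : R).
Hypotheses (alpha_lt : alpha < n%:R) (gamma_ge0 : 0 <= gamma).
Local Notation K := (@bessel_riesz_kernel R n alpha gamma).

Lemma bessel_riesz_radial_ge (x : Rn R n) :
  ((v * 2 ^- n * (K x * radial_fun x * enorm x ^+ n))%:E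
   <= bessel_riesz alpha gamma radial_fun x)%E.
Proof.
have K0 := @bessel_riesz_kernel_ge0 R n alpha gamma.
have Ig0 z : (0 <= bessel_riesz alpha gamma radial_fun z)%E.
  by apply: integral_ge0 => y _; rewrite lee_fin mulr_ge0// g0.
(* At the origin the kernel has value 0, and the claim is nonnegativity. *)
have [->|x0] := eqVneq x (torigin n).
  by rewrite (bessel_riesz_kernel0 _ alpha_lt) !mul0r mulr0; exact: Ig0.
have {}x0 : 0 < enorm x by rewrite enorm_gt0.
have x20 : 0 < enorm x / 2 by rewrite divr_gt0.
pose B := eball (taffine 2^-1 (torigin n) x) (enorm x / 2).
have mB : measurable B := measurable_eball _ _.
have -> : (v * 2 ^- n * (K x * radial_fun x * enorm x ^+ n))%:E =
    ((K x * radial_fun x)%:E * mu B)%E.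
  by rewrite vE// -EFinM expr_div_n; congr EFin; ring.
apply: integral_ge_cst => //.
- by rewrite mulr_ge0// g0.
- by move=> y _; rewrite lee_fin mulr_ge0// g0.
move=> y /half_ball_bounds[y0 yx xy0 xyx]; rewrite lee_fin ler_pM ?g0//.
- exact: bessel_riesz_kernel_le.
- exact: gmono.
Qed.

Lemma integral_kernel_le (T rho : R) : 0 < rho -> 0 <= T ->
  (gmorrey_norm p2 (fun r => (phi r * r `^ (n%:R / t'))%R)
     (bessel_riesz alpha gamma radial_fun) <= T%:E)%E ->
  (\int[mu]_(x in eball (torigin n) rho) (K x `^ p1)%:E
   <= (((cw * c)^-1 * (T * rho `^ (- (n%:R / t)) * 2 ^+ n / v)
        * (Cr * C3 / v) `^ s'^-1) `^ p1 * (v * rho ^+ n))%:E)%E.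
Proof.
move=> rho0 T0 hT; have ph0 := phi_gt0 rho0.
have V0 := ball_volume_gt0 (n := n) v0 rho0; set V := v * rho ^+ n in V0 *.
have K0 := @bessel_riesz_kernel_ge0 R n alpha gamma.
set psi := phi rho * rho `^ (n%:R / t').
have psi0 : 0 < psi by rewrite mulr_gt0 ?powR_gt0.
set B := eball (torigin n) rho.
have mB : measurable B := measurable_eball _ _.
have vi : 0 < v^-1 by rewrite invr_gt0.
have vn0 : 0 < v * 2 ^- n by rewrite mulr_gt0// invr_gt0 exprn_gt0.
have nvn0 : 0 < (v * 2 ^- n)^-1 by rewrite invr_gt0.
have vnE : (v * 2 ^- n)^-1 = 2 ^+ n / v by rewrite invfM invrK mulrC.
have cwc0 : 0 < (cw * c)^-1 by rewrite invr_gt0 mulr_gt0.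
pose J x := K x * radial_fun x * enorm x ^+ n.
have J0 x : 0 <= J x by rewrite /J mulr_ge0 ?exprn_ge0 ?enorm_ge0// mulr_ge0//
  g0.
have mK := @measurable_bessel_riesz_kernel R n alpha gamma.
have mJ : measurable_fun setT J.
  apply: measurable_funM; last by apply: measurable_funX;
    exact: measurable_enorm.
  by apply: measurable_funM => //; exact: measurable_radial_fun.
(* [v * 2 ^- n * J] lies below the image of the test function, whose [L^p2] mean is at most
   [T psi(rho)]. *)
have hJ : (\int[mu]_(x in B) (J x `^ p2)%:E <= ((T * psi * (2 ^+ n / v)) `^ p2
  * V)%:E)%E.
  have h := @gmorrey_normP R n v v0 vE p2 (fun r => phi r * r `^ (n%:R / t'))
    _ T (torigin n) rho p2_gt0 rho0 psi0 hT.
  apply: (@le_trans _ _ (\int[mu]_(x in B)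
      (((2 ^+ n / v) `^ p2)%:E * (((v * 2 ^- n) * J x) `^ p2)%:E))%E).
    apply: le_integral_nonneg => x _; first by rewrite lee_fin powR_ge0.
    have nv0 : 0 <= 2 ^+ n / v by rewrite -vnE ltW.
    have vJ0 : 0 <= (v * 2 ^- n) * J x by rewrite mulr_ge0// ltW.
    by rewrite -EFinM lee_fin -(powRM _ nv0 vJ0) mulrA -vnE mulVf ?gt_eqF//
      mul1r.
  have mvJ : measurable_fun B (fun x => (((v * 2 ^- n) * J x) `^ p2)%:E).
    apply: measurable_funTS; apply/measurable_EFinP; apply: measurable_powR_fun.
    exact: measurable_funM.
  rewrite (ge0_integralZl mu mB mvJ); last 2 first.
  - by move=> x _; rewrite lee_fin powR_ge0.
  - by rewrite lee_fin powR_ge0.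
  have nv0 : 0 <= 2 ^+ n / v by rewrite -vnE ltW.
  have Tpsi0 : 0 <= T * psi by rewrite mulr_ge0// ltW.
  have -> : ((T * psi * (2 ^+ n / v)) `^ p2 * V)%:E =
    (((2 ^+ n / v) `^ p2)%:E * ((T * psi) `^ p2 * V)%:E)%E.
    by rewrite -EFinM powRM//; congr EFin; ring.
  apply: lee_wpmul2l; first by rewrite lee_fin powR_ge0.
  apply: le_trans h; apply: le_integral_nonneg => x _; first
    by rewrite lee_fin powR_ge0.
  rewrite -poweR_EFin; apply: gt0_ler_poweR;
    rewrite ?(ltW p2_gt0)// ?in_itv/= ?leey ?andbT//.
    by rewrite lee_fin mulr_ge0// ltW.
  by apply: le_trans (lee_abs _); exact: bessel_riesz_radial_ge.
have hW := integral_dual_le rho0.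
(* Off the origin [phi] cancels between [g >= c phi] and [w >= cw/(phi r^n)], leaving [cw * c]. *)
have KJW x : K x <= (cw * c)^-1 * (J x * w (enorm x)).
  have [->|x0] := eqVneq x (torigin n).
    rewrite (bessel_riesz_kernel0 _ alpha_lt) mulr_ge0 ?(ltW cwc0)// mulr_ge0//.
  have {}x0 : 0 < enorm x by rewrite enorm_gt0.
  have phx := phi_gt0 x0.
  have /andP[w1 _] := phiw x0; have /andP[g1 _] := phig x0.
  rewrite ler_pdivlMl ?mulr_gt0// /J /radial_fun.
  move: (K x) (K0 x) => k k0; rewrite mulrC -!mulrA; apply: ler_wpM2l => //.
  set e := enorm x in x0 phx w1 g1 *.
  have -> : cw * c = (c * phi e) * (e ^+ n * (cw * (phi e * e ^+ n)^-1)).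
    by field; rewrite !gt_eqF// exprn_gt0.
  apply: ler_pM => //.
  - by rewrite mulr_ge0// ltW.
  - by rewrite mulr_ge0 ?exprn_ge0 ?(ltW x0)// mulr_ge0 ?(ltW cw0)// invr_ge0
    mulr_ge0 ?exprn_ge0// ltW.
  - by apply: ler_wpM2l => //; rewrite exprn_ge0// ltW.
(* By the relation defining [p2], the weights [p1/p2] and [p1/s'] add up to 1; applied to [J^p2] and
   [w^s'] they produce the power [p1] of [J w]. *)
pose a := p1 / p2.
have aE : 1 - a = p1 / s' by rewrite /a p12; field; rewrite !gt_eqF.
have a01 : 0 <= a <= 1.
  rewrite divr_ge0 ?(ltW p1_gt0) ?(ltW p2_gt0)//= -subr_ge0 aE.
  by rewrite divr_ge0 ?(ltW p1_gt0) ?(ltW s'_gt0).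
have pE2 : p2 * (p1 / p2) = p1 by rewrite mulrCA mulfV ?mulr1// gt_eqF.
have pE3 : s' * (p1 / s') = p1 by rewrite mulrCA mulfV ?mulr1// gt_eqF.
have combine (x y z : R) : 0 <= x -> 0 <= y -> 0 < z ->
    (x `^ p2 * z) `^ a * (y `^ s' * z) `^ (1 - a) = (x * y) `^ p1 * z.
  move=> x0 y0 z0; have z0' := ltW z0.
  rewrite (powRM _ (powR_ge0 _ _) z0') (powRM _ (powR_ge0 _ _) z0') (powRM _ x0
    y0).
  rewrite -!powRrM aE /a pE2 pE3 mulrACA -powRD ?(gt_eqF z0) ?implybT//.
  have -> : p1 / p2 + p1 / s' = 1 by rewrite p12; field; rewrite !gt_eqF.
  by rewrite powRr1.
pose FJ x := J x `^ p2 * \1_B x; pose FW x := w (enorm x) `^ s' * \1_B x.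
have mI : measurable_fun setT (\1_B : Rn R n -> R) by exact: measurable_indic.
have mFJ : measurable_fun setT FJ by apply: measurable_funM => //;
  exact: measurable_powR_fun.
have mFW : measurable_fun setT FW.
  apply: measurable_funM => //; apply: measurable_powR_fun.
  exact: (measurableT_comp mw (@measurable_enorm R n)).
have FJ0 x : 0 <= FJ x by rewrite mulr_ge0 ?powR_ge0.
have FW0 x : 0 <= FW x by rewrite mulr_ge0 ?powR_ge0.
have hol := integral_powR_mul mu mFJ mFW FJ0 FW0 a01.
have FJE : (\int[mu]_x (FJ x)%:E = \int[mu]_(x in B) (J x `^ p2)%:E)%E.
  rewrite [RHS]integral_mkcond; apply: eq_integral => x _;
    rewrite /patch /FJ indicE.
  by case: ifPn => xB; rewrite ?mulr1 ?mulr0.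
have FWE : (\int[mu]_x (FW x)%:E = \int[mu]_(x in B) (w (enorm x) `^ s')%:E)%E.
  rewrite [RHS]integral_mkcond; apply: eq_integral => x _;
    rewrite /patch /FW indicE.
  by case: ifPn => xB; rewrite ?mulr1 ?mulr0.
rewrite FJE FWE in hol.
apply: (@le_trans _ _ ((((cw * c)^-1) `^ p1)%:E * \int[mu]_x (FJ x `^ a * FW x
  `^ (1 - a))%:E)%E).
  have mFF : measurable_fun setT (fun x => (FJ x `^ a * FW x `^ (1 - a))%:E).
    by apply/measurable_EFinP; apply: measurable_funM;
      exact: measurable_powR_fun.
  rewrite -(ge0_integralZl mu measurableT mFF); last 2 first.
  - by move=> x _; rewrite lee_fin mulr_ge0 ?powR_ge0.
  - by rewrite lee_fin powR_ge0.
  rewrite [leLHS]integral_mkcond; apply: le_integral_nonneg => x _.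
    by rewrite /patch; case: ifPn => // _; rewrite lee_fin powR_ge0.
  rewrite /patch -EFinM; case: ifPn => xB; last first.
    by rewrite lee_fin mulr_ge0 ?powR_ge0// mulr_ge0 ?powR_ge0.
  rewrite lee_fin /FJ /FW indicE xB !mulr1 aE -!powRrM /a.
  have Jw0 : 0 <= J x * w (enorm x) by exact: mulr_ge0.
  rewrite pE2 pE3 -(powRM _ (J0 x) (w0 _)) -(powRM _ (ltW cwc0) Jw0).
  by apply: le_powR; rewrite ?(ltW p1_gt0).
apply: (@le_trans _ _ ((((cw * c)^-1) `^ p1)%:E *
   (((T * psi * (2 ^+ n / v)) `^ p2 * V)%:E `^ a *
    (((Cr * C3 / v) `^ s'^-1 * (phi rho * rho ^+ n)^-1) `^ s' * V)%:E `^ (1 -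
      a)))%E).
  apply: lee_wpmul2l; first by rewrite lee_fin powR_ge0.
  apply: (le_trans hol); apply: lee_pmul; rewrite ?poweR_ge0//.
  - apply: gt0_ler_poweR => //; first by case/andP: a01.
    + by rewrite in_itv/= leey andbT integral_ge0// => x _;
      rewrite lee_fin powR_ge0.
    + by rewrite in_itv/= leey andbT lee_fin mulr_ge0 ?powR_ge0// ltW.
  - apply: gt0_ler_poweR => //; first by rewrite subr_ge0; case/andP: a01.
    + by rewrite in_itv/= leey andbT integral_ge0// => x _;
      rewrite lee_fin powR_ge0.
    + by rewrite in_itv/= leey andbT lee_fin mulr_ge0 ?powR_ge0// ltW.
rewrite !poweR_EFin -!EFinM lee_fin.
set X := T * psi * (2 ^+ n / v); set Y := (Cr * C3 / v) `^ s'^-1 * _.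
have X0 : 0 <= X by rewrite /X -vnE; nonneg.
have Y0 : 0 <= Y by rewrite mulr_ge0 ?powR_ge0// invr_ge0 mulr_ge0 ?exprn_ge0//
  ltW.
rewrite combine//.
rewrite mulrA -(powRM _ (ltW cwc0) (mulr_ge0 X0 Y0)).
rewrite le_eqVlt; apply/orP; left; apply/eqP; congr (_ `^ _ * _).
(* In [psi(rho)/(phi(rho) rho^n)] the function [phi] disappears, and [rho^(n/t' - n) = rho^(-n/t)]
   remains. *)
have -> : rho `^ (- (n%:R / t)) = rho `^ (n%:R / t') / rho ^+ n.
  rewrite -powR_mulrn ?(ltW rho0)// -powRN -powRD ?(gt_eqF rho0) ?implybT//.
  congr (_ `^ _); have -> : t'^-1 = 1 - t^-1 by rewrite -tt' addrAC subrr add0r.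
  by ring.
rewrite /X /Y /psi; field; rewrite !gt_eqF ?exprn_gt0//.
Qed.

Lemma integral_kernel_ball_le (a : Rn R n) (r : R) : 0 < r ->
  (\int[mu]_(x in eball a r) (K x `^ p1)%:E
   <= \int[mu]_(x in eball (torigin n) (3 * r)) (K x `^ p1)%:E)%E.
Proof.
move=> r0; have mB := @measurable_eball R n.
have K0 := @bessel_riesz_kernel_ge0 R n alpha gamma.
have [ar|ar] := leP (2 * r) (enorm a); last first.
  rewrite integral_mkcond [leRHS]integral_mkcond; apply: le_integral_nonneg =>
    x _.
    by rewrite /patch; case: ifPn => // _; rewrite lee_fin powR_ge0.
  rewrite /patch; case: ifPn => [/set_mem xB|_].
    by rewrite mem_set//; exact: eball_sub_centered xB.
  by case: ifPn => // _; rewrite lee_fin powR_ge0.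
have a0 : 0 < enorm a by apply: lt_le_trans ar; rewrite mulr_gt0.
(* The point of norm [r] in the direction of [a]: its kernel value is an upper bound on the distant
   ball and a lower bound on the centred ball of radius [r], origin excepted. *)
pose b := taffine (r / enorm a) (torigin n) a.
have bE : enorm b = r by rewrite enorm_scale ger0_norm ?divr_ge0 ?enorm_ge0
  ?(ltW r0)// divfK ?gt_eqF.
have far x : eball a r x -> K x <= K b.
  move=> xB; apply: bessel_riesz_kernel_le; rewrite ?bE//.
  exact/ltW/(enorm_ge_far ar xB).
have near x : 0 < enorm x < r -> K b <= K x.
  by move=> /andP[x0 xr]; apply: bessel_riesz_kernel_le; rewrite ?bE// ltW.
move: (K b) (K0 b) far near => k k0 far near.
apply: (@le_trans _ _ ((k `^ p1 * (v * r ^+ n))%:E)).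
  rewrite EFinM -(vE a r0); apply: integral_le_cst => [|x _|x xB].
  - exact: mB.
  - by rewrite lee_fin powR_ge0.
  by rewrite lee_fin; apply: le_powR; [exact: ltW|exact: K0|exact: far].
apply: (@le_trans _ _ (\int[mu]_(x in eball (torigin n) r) (K x `^ p1)%:E)%E).
  apply: ge_integral_centered_ball => [|||x|x xr].
  - exact: n_gt0.
  - exact: powR_ge0.
  - exact: vE.
  - by rewrite lee_fin powR_ge0.
  by rewrite lee_fin; apply: le_powR; [exact: ltW|exact: k0|exact: near].
rewrite integral_mkcond [leRHS]integral_mkcond; apply: le_integral_nonneg =>
  x _.
  by rewrite /patch; case: ifPn => // _; rewrite lee_fin powR_ge0.
rewrite /patch; case: ifPn => [/set_mem xB|_].
  by rewrite mem_set//; rewrite /eball/= in xB *; lra.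
by case: ifPn => // _; rewrite lee_fin powR_ge0.
Qed.

(** The factors stem from the minorants [g] and [w], the half-radius ball, the dual integral, the
    passage to triple radius, and the power [1/t] of the ball volume. *)
Definition lower_constant :=
  (cw * c)^-1 * (2 ^+ n / v) * (Cr * C3 / v) `^ s'^-1 *
  3 `^ (n%:R / p1 - n%:R / t) * v `^ t^-1.

Lemma lower_constant_gt0 : 0 < lower_constant.
Proof.
by rewrite /lower_constant !mulr_gt0 ?powR_gt0 ?invr_gt0 ?mulr_gt0 ?exprn_gt0
  ?invr_gt0.
Qed.

Lemma morrey_norm_kernel_le (T : R) : 0 <= T ->
  (gmorrey_norm p2 (fun r => (phi r * r `^ (n%:R / t'))%R)
     (bessel_riesz alpha gamma radial_fun) <= T%:E)%E ->
  (morrey_norm p1 t (EFin \o K) <= (lower_constant * T)%:E)%E.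
Proof.
move=> T0 hT; apply: ge_ereal_sup => _ [a [r [r0 ->]]].
have V0 := ball_volume_gt0 (n := n) v0 r0.
have r30 : 0 < 3 * r by rewrite mulr_gt0.
have K0 := @bessel_riesz_kernel_ge0 R n alpha gamma.
have h := le_trans (integral_kernel_ball_le a r0) (integral_kernel_le r30 T0
  hT).
rewrite vE// poweR_EFin.
have -> : (\int[mu]_(x in eball a r) (`|(EFin \o K) x| `^ p1) =
    \int[mu]_(x in eball a r) (K x `^ p1)%:E)%E.
  by apply: eq_integral => x _; rewrite /= ger0_norm.
set E := (cw * c)^-1 * _ * _ in h.
have cwc0 : 0 <= (cw * c)^-1 by rewrite invr_ge0 mulr_ge0// ltW.
have vi : 0 <= v^-1 by rewrite invr_ge0 ltW.
have E0 : 0 <= E by rewrite /E; nonneg.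
have W0 : 0 < v * (3 * r) ^+ n by rewrite ball_volume_gt0.
set W := v * (3 * r) ^+ n in h W0.
have {}h : ((\int[mu]_(x in eball a r) (K x `^ p1)%:E) `^ p1^-1 <= (E * W `^
  p1^-1)%:E)%E.
  apply: root_le_of_poweR => //.
  - by apply: integral_ge0 => x _; rewrite lee_fin powR_ge0.
  - by rewrite mulr_ge0 ?powR_ge0.
  by rewrite powRM ?powR_ge0// -powRrM mulVf ?gt_eqF// powRr1// ltW.
apply: (@le_trans _ _ (((v * r ^+ n) `^ (t^-1 - p1^-1))%:E * (E * W `^
  p1^-1)%:E)%E).
  by apply: lee_wpmul2l => //; rewrite lee_fin powR_ge0.
rewrite -EFinM lee_fin le_eqVlt; apply/orP; left; apply/eqP.
have WE : W = 3 `^ n%:R * (v * r ^+ n) by rewrite /W powR_mulrn// exprMn; ring.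
have -> : W `^ p1^-1 = 3 `^ (n%:R / p1) * (v * r ^+ n) `^ p1^-1.
  by rewrite WE (powRM _ (powR_ge0 _ _) (ltW V0)) -powRrM.
have -> : (v * r ^+ n) `^ (t^-1 - p1^-1) * (E * (3 `^ (n%:R / p1) * (v * r ^+
  n) `^ p1^-1))
  = E * 3 `^ (n%:R / p1) * ((v * r ^+ n) `^ (t^-1 - p1^-1) * (v * r ^+ n) `^
    p1^-1) by ring.
rewrite -powRD ?(gt_eqF V0) ?implybT// subrK.
have -> : (v * r ^+ n) `^ t^-1 = v `^ t^-1 * r `^ (n%:R / t).
  by rewrite powRM ?exprn_ge0 ?(ltW r0) ?(ltW v0)// -powR_mulrn ?(ltW r0)//
    -powRrM.
rewrite /E /lower_constant (powRM _ _ (ltW r0))//.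
have -> : 3 `^ (n%:R / p1 - n%:R / t) = 3 `^ (n%:R / p1) * 3 `^ (- (n%:R / t))
  :> R.
  by rewrite powRD// pnatr_eq0 implybT.
have rr : r `^ (- (n%:R / t)) * r `^ (n%:R / t) = 1.
  by rewrite -powRD ?(gt_eqF r0) ?implybT// addNr powRr0.
transitivity ((cw * c)^-1 * (2 ^+ n / v) * (Cr * C3 / v) `^ s'^-1 *
  (3 `^ (n%:R / p1) * 3 `^ (- (n%:R / t))) * v `^ t^-1 * T *
  (r `^ (- (n%:R / t)) * r `^ (n%:R / t))); first by ring.
by rewrite rr mulr1.
Qed.

(** The quotient for the test function belongs to the supremum, so an upper bound for the norm of
    that function turns its image norm into a lower bound for the operator norm. *)
Lemma morrey_norm_kernel_le_op_norm :
  (@morrey_norm R n p1 t (EFin \o K) <= (lower_constant * radial_norm)%:E *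
    @op_norm R n (gmorrey p1 phi) (gmorrey_norm p1 phi)
     (gmorrey_norm p2 (fun r => (phi r * r `^ (n%:R / t'))%R)) (bessel_riesz
       alpha gamma))%E.
Proof.
set op := op_norm _ _ _ _.
set Tf := gmorrey_norm p2 (fun r => (phi r * r `^ (n%:R / t'))%R)
  (bessel_riesz alpha gamma radial_fun).
have L0 := lower_constant_gt0; have F0 := radial_norm_gt0.
have Tf0 : (0 <= Tf)%E.
  apply: le_trans (ereal_sup_ubound _); last first.
    by exists (torigin n), 1; split; [exact: ltr01|reflexivity].
  by rewrite mule_ge0 ?poweR_ge0// lee_fin invr_ge0 mulr_ge0 ?powR_ge0// ltW//
    phi_gt0.
have N_gt0 := gmorrey_norm_gt0 p1_ge1 phi_gt0 measurable_radial_fun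
  radial_fun_neq0.
have N_le := gmorrey_norm_radial_fun_le.
set N := gmorrey_norm p1 phi _ in N_gt0 N_le.
have Nfin : N \is a fin_num by rewrite ge0_fin_numE ?(ltW N_gt0)// (le_lt_trans
  N_le) ?ltry.
have opT : (Tf <= radial_norm%:E * op)%E.
  have : (Tf / N <= op)%E.
    by apply: ereal_sup_ubound; exists radial_fun => //; split;
      [exact: gmorrey_radial_fun|exact: radial_fun_neq0].
  move: N_gt0 N_le; rewrite -(fineK Nfin) lte_fin lee_fin => N_gt0 N_le.
  rewrite inver gt_eqF// => h.
  have op0 : (0 <= op)%E by apply: le_trans h;
    rewrite mule_ge0// lee_fin invr_ge0 ltW.
  have {}h : (Tf <= (fine N)%:E * op)%E by rewrite -lee_pdivrMl// muleC.
  by apply: (le_trans h); apply: lee_wpmul2r; rewrite ?lee_fin.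
apply: (@le_trans _ _ (lower_constant%:E * Tf)%E); last first.
  have -> : ((lower_constant * radial_norm)%:E * op =
      lower_constant%:E * (radial_norm%:E * op))%E by rewrite muleA.
  by apply: lee_wpmul2l; rewrite ?lee_fin ?(ltW L0).
have [->|] := eqVneq Tf +oo%E; first by rewrite gt0_muley ?leey// lte_fin.
rewrite -ltey => Tflt.
have Tffin : Tf \is a fin_num by rewrite ge0_fin_numE.
rewrite -(fineK Tffin) -EFinM; apply: morrey_norm_kernel_le.
- exact: fine_ge0.
- by rewrite (fineK Tffin).
Qed.

End lower_bound.

(** * The exponent condition and the theorem *)

Section exponents.
Context {R : realType}.
Local Notation mu := (@lebesgue_measure R).

(* Halving the variable shows that the integral exceeds itself by [1/2]. *)
Lemma integral_inv_eq_pinfty :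
  (\int[mu]_(r in `[1%R, +oo[) (r `^ (-1))%:E = +oo)%E.
Proof.
pose h (r : R) := r `^ (-1) * \1_`[1, +oo[%classic r.
have hE : (\int[mu]_(r in `[1%R, +oo[) (r `^ (-1))%:E = \int[mu]_r (h r)%:E)%E.
  rewrite integral_mkcond; apply: eq_integral => r _; rewrite /patch /h indicE.
  by case: ifPn => _; rewrite ?mulr1 ?mulr0.
rewrite hE; set J := (\int[mu]_r _)%E.
have h0 r : 0 <= h r by rewrite mulr_ge0 ?powR_ge0.
have mh : measurable_fun setT h.
  by apply: measurable_funM; [exact: measurable_powR|exact: measurable_indic].
have J0 : (0 <= J)%E by apply: integral_ge0 => r _; rewrite lee_fin.
(* On [[1, 2[] the function [1/r] exceeds [1/2]; from 2 on it equals [h(r/2)/2], whose integral is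
   again [J]. *)
pose k (r : R) : R := 2^-1 * \1_`[1, 2[%classic r.
have k0 r : 0 <= k r by rewrite /k mulr_ge0.
have hh0 r : 0 <= 2^-1 * h (2^-1 * r + 0) by rewrite mulr_ge0.
have half_scale : (\int[mu]_r (h (2^-1 * r + 0)%R)%:E = 2%:E * J)%E.
  rewrite (@ge0_integral_affine1 R 2^-1 0 (EFin \o h))//.
  - by rewrite ger0_norm// invrK.
  - exact/measurable_EFinP.
have mh2 : measurable_fun setT (fun r : R => h (2^-1 * r + 0)).
  apply: (measurableT_comp (f := h)) => //.
  by apply: measurable_funD => //; exact: measurable_funM.
have m2 : measurable_fun setT (fun r : R => (2^-1 * h (2^-1 * r + 0)%R)%:E).
  by apply/measurable_EFinP; exact: measurable_funM.
have mk : measurable_fun setT (fun r : R => (k r)%:E).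
  by apply/measurable_EFinP; apply: measurable_funM => //;
    exact: measurable_indic.
have ik : (\int[mu]_r (k r)%:E = (2^-1)%:E)%E.
  rewrite integral_cst_indic// -[RHS]mule1; congr (_ * _)%E.
  rewrite [LHS]lebesgue_measure_itv/= lte_fin ltr1n/= -EFinB.
  by congr EFin; lra.
have ih : (\int[mu]_r (2^-1 * h (2^-1 * r + 0)%R)%:E = J)%E.
  under eq_integral do rewrite EFinM.
  have mh2E : measurable_fun setT (fun r : R => (h (2^-1 * r + 0))%:E).
    exact/measurable_EFinP.
  rewrite (ge0_integralZl mu measurableT mh2E); last 2 first.
  - by move=> r _; rewrite lee_fin.
  - by rewrite lee_fin.
  by rewrite half_scale muleA -EFinM mulVf ?mul1e.
have le_J : ((2^-1)%:E + J <= J)%E.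
  have -> : ((2^-1)%:E + J)%E = (\int[mu]_r ((k r)%:E + (2^-1 * h (2^-1 * r +
    0)%R)%:E))%E.
    rewrite ge0_integralD//.
    - by rewrite ik ih.
    - by move=> r _; rewrite lee_fin mulr_ge0.
    - by move=> r _; rewrite lee_fin mulr_ge0.
  apply: le_integral_nonneg => r _; first by rewrite -EFinD lee_fin addr_ge0.
  rewrite -EFinD lee_fin addr0 /k /h !indicE !mem_setE !in_itv/= !andbT.
  have [r1|r1] := ltP r 1.
    by rewrite ltNge -ltNge (_ : (1 <= 2^-1 * r) = false) ?mulr0 ?addr0//; lra.
  have [r2|r2] := ltP r 2.
    rewrite (_ : (1 <= 2^-1 * r) = false) ?mulr0 ?addr0 ?mulr1; last by lra.
    by rewrite powR_inv1 ?lef_pV2 ?posrE; lra.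
  rewrite (_ : (1 <= 2^-1 * r) = true) ?mulr0 ?add0r ?mulr1; last by lra.
  have r0 : 0 < r by lra.
  by rewrite !powR_inv1 ?mulr_ge0 ?(ltW r0)// invfM invrK mulrA mulVf// mul1r.
apply/eqP; rewrite -leye_eq leNgt; apply/negP => Jlt.
have Jfin : J \is a fin_num by rewrite ge0_fin_numE.
by move: le_J; rewrite -(fineK Jfin) -EFinD lee_fin; lra.
Qed.

(** On [[1, +oo[] the product [phi(r) r^(n/p)] stays above some [m > 0]. If [1/t' >= 1/p], the
    integrand in (i) would dominate [m/r], which is not integrable. *)
Lemma class_G_tail_exponent (n : nat) (p t' : R) (phi : R -> R) (M : R) :
  (0 < n)%N -> 1 <= p -> class_G n p phi ->
  (\int[mu]_(r in `[1%R, +oo[) (phi r * r `^ (n%:R / t' - 1))%:E <= M%:E)%E ->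
  t'^-1 < p^-1.
Proof.
move=> n0 p1 [ph0 _ [C C0 hC]] hM; rewrite ltNge; apply/negP => pt.
have p0 : 0 < p by exact: lt_le_trans p1.
have pn : 0 <= p^-1 by rewrite invr_ge0 ltW.
have nR : 0 < n%:R :> R by rewrite ltr0n.
pose m := (phi 1 `^ p / C) `^ p^-1.
have q0 : 0 < phi 1 `^ p / C by rewrite divr_gt0 ?powR_gt0 ?ph0.
have m0 : 0 < m by rewrite powR_gt0.
have lower r : 1 <= r -> m * r `^ (-1) <= phi r * r `^ (n%:R / t' - 1).
  move=> r1; have r0 : 0 < r by lra.
  have h1 : phi 1 `^ p / C <= phi r `^ p * r ^+ n.
    by rewrite ler_pdivrMr// mulrC; have := hC 1 r ltr01 r1;
      rewrite expr1n mulr1.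
  have h2 : m <= phi r * r `^ (n%:R / p).
    have -> : phi r * r `^ (n%:R / p) = (phi r `^ p * r ^+ n) `^ p^-1.
      rewrite powRM ?powR_ge0 ?exprn_ge0 ?(ltW r0)// -powRrM mulfV ?gt_eqF//.
      by rewrite powRr1 ?(ltW (ph0 _ r0))// -powR_mulrn ?(ltW r0)// -powRrM.
    by apply: ge0_ler_powR; rewrite ?nnegrE ?(ltW q0)// (le_trans (ltW q0)).
  have -> : r `^ (n%:R / t' - 1) = r `^ (n%:R / t') * r `^ (-1).
    by rewrite powRD// (gt_eqF r0) implybT.
  rewrite mulrA ler_wpM2r ?powR_ge0//; apply: (le_trans h2).
  by rewrite ler_wpM2l ?(ltW (ph0 _ r0))// ler_powR// ler_wpM2l// ltW.
have : (m%:E * \int[mu]_(r in `[1%R, +oo[) (r `^ (-1))%:E <= M%:E)%E.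
  have minv (D : set (measurableTypeR R)) :
      measurable_fun D (fun r : R => (r `^ (-1))%:E).
    by apply: measurable_funTS; apply/measurable_EFinP; exact: measurable_powR.
  apply: le_trans hM; rewrite -(ge0_integralZl mu (measurable_itv _) (minv _));
    last 2 first.
  - by move=> r _; rewrite lee_fin powR_ge0.
  - by rewrite lee_fin ltW.
  apply: le_integral_nonneg => r.
    by rewrite mule_ge0 ?lee_fin ?powR_ge0// ltW.
  by rewrite /= in_itv/= andbT => r1; rewrite -EFinM lee_fin lower.
by rewrite integral_inv_eq_pinfty gt0_muley// leye_eq.
Qed.

End exponents.

Theorem theorem3p1 (R : realType) (n : nat) (phi : R -> R)
    (p1 s t s' t' p2 : R) :
  1 <= p1 ->
  s^-1 + s'^-1 = 1 ->
  t^-1 + t'^-1 = 1 ->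
  p2^-1 = p1^-1 - s'^-1 ->
  class_G n p1 phi ->
  almost_increasing (fun r => phi r * r ^+ n) ->
  (exists2 C1 : R, 0 < C1 & forall rho : R, 0 < rho ->
    (\int[lebesgue_measure]_(r in `[rho, +oo[)
       (phi r * r `^ (n%:R / t' - 1))%:E
     <= (C1 * phi rho * rho `^ (n%:R / t'))%:E)%E) ->
  (exists2 C2 : R, 0 < C2 & forall rho : R, 0 < rho ->
    (\int[lebesgue_measure]_(r in `]0%R, rho])
       (phi r `^ p1 * r `^ (n%:R - 1))%:E
     <= (C2 * phi rho `^ p1 * rho ^+ n)%:E)%E) ->
  (exists2 C3 : R, 0 < C3 & forall rho : R, 0 < rho ->
    (\int[lebesgue_measure]_(r in `]0%R, rho])
       (r `^ (n%:R - 1) / (phi r `^ s' * r `^ (n%:R * s')))%:E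
     <= (C3 * rho ^+ n / (phi rho `^ s' * rho `^ (n%:R * s')))%:E)%E) ->
  let psi := fun r : R => phi r * r `^ (n%:R / t') in
  let opn := @op_norm R n (gmorrey p1 phi)
               (gmorrey_norm p1 phi) (gmorrey_norm p2 psi) in
  exists C4 C5 : R,
  [/\ 0 < C4, 0 < C5,
    forall alpha gamma : R,
      0 < alpha < n%:R -> 0 <= gamma -> p1 < n%:R / alpha ->
      [/\ p1 < t, 1 < s, s < t & t = n%:R / (n%:R - alpha)] \/
      [/\ 0 < gamma, p1 <= t, 1 < s, s <= t &
          n%:R / (n%:R + gamma - alpha) < t < n%:R / (n%:R - alpha)] ->
      (C4%:E * @morrey_norm R n p1 t (EFin \o bessel_riesz_kernel alpha gamma)
         <= opn (bessel_riesz alpha gamma)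
         <= C5%:E * @morrey_norm R n s t (EFin \o bessel_riesz_kernel alpha gamma))%E
  & forall alpha : R,
      0 < alpha < n%:R -> p1 < n%:R / alpha ->
      p1 < t -> 1 < s -> s < t -> t = n%:R / (n%:R - alpha) ->
      (C4%:E * @morrey_norm R n p1 t (EFin \o riesz_kernel alpha)
         <= opn (riesz alpha)
         <= C5%:E * @morrey_norm R n s t (EFin \o riesz_kernel alpha))%E].
Proof.
move=> p1_ge1 ss' tt' p12 phiG phi_inc phi_tail phi_head phi_dual psi opn.
(* The constants precede [alpha] and [gamma], yet [n > 0] and [1 < s <= t] follow only from an
   admissible choice of them. If these facts fail, no choice is admissible and the constants 1
   serve. *)
have [[n0 [s1 st]]|degenerate] := pselect ((0 < n)%N /\ (1 < s /\ s <= t));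
  last first.
  have absurd (alpha : R) : 0 < alpha < n%:R -> 1 < s -> s <= t -> False.
    move=> /andP[a0 an] s1 st; apply: degenerate; split=> //.
    by have := lt_trans a0 an; rewrite ltr0n.
  exists 1, 1; split => // [alpha gamma a0n _ _ [[_ s1 st _]|[_ _ s1 st
    _]]|alpha a0n _ _ s1 st _].
  - by case: (absurd alpha a0n s1 (ltW st)).
  - by case: (absurd alpha a0n s1 st).
  - by case: (absurd alpha a0n s1 (ltW st)).
have [phi_gt0 phi_dec _] := phiG.
have [C1 C1_gt0 hC1] := phi_tail.
have [C2 C2_gt0 hC2] := phi_head.
have [C3 C3_gt0 hC3] := phi_dual.
have s0 : 0 < s by exact: lt_trans s1.
have t0 : 0 < t by exact: lt_le_trans st.
have p10 : 0 < p1 by exact: lt_le_trans p1_ge1.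
have sV : s^-1 < 1 by rewrite invf_lt1.
have s'_gt0 : 0 < s' by rewrite -invr_gt0; lra.
have tp : t'^-1 < p1^-1.
  exact: class_G_tail_exponent n0 p1_ge1 phiG (hC1 1 ltr01).
have tsV : t^-1 <= s^-1 by rewrite lef_pV2.
(* From [s <= t] one gets [1/s' <= 1/t' < 1/p1]. *)
have p2_gt0 : 0 < p2 by rewrite -invr_gt0 p12; lra.
have spq : s^-1 + p1^-1 = 1 + p2^-1 by rewrite p12; lra.
have [C5 C5_gt0 upper] := op_norm_bessel_riesz_le n0 p1_ge1 s1 t0 tt' p2_gt0 spq
  phi_gt0 phi_dec phi_tail.
have [v v0 vE] := @lebesgue_n_ball R n.
have [Cr Cr0 radial] := @radial_integral_le R n.
have [g [c c0 [mg gz g0 gmono phig]]] := almost_decreasing_minorant phi_gt0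
  phi_dec.
have inv_gt0 : pos_fun (fun r => (phi r * r ^+ n)^-1).
  by move=> r r0; rewrite invr_gt0 mulr_gt0 ?exprn_gt0 ?phi_gt0.
(* Inversion turns the almost increase of [phi(r) r^n] into almost decrease, with the inverse
   constant; this is what yields [w]. *)
have inv_dec : almost_decreasing (fun r => (phi r * r ^+ n)^-1).
  have [C C0 hC] := phi_inc; exists C^-1; first by rewrite invr_gt0.
  move=> r u r0 ru; have u0 := lt_le_trans r0 ru.
  rewrite -invfM lef_pV2 ?posrE ?hC//.
    by rewrite mulr_gt0// mulr_gt0 ?exprn_gt0 ?phi_gt0.
  by rewrite mulr_gt0 ?exprn_gt0 ?phi_gt0.
have [w [cw cw0 [mw wz w0 wmono phiw]]] := almost_decreasing_minorant inv_gt0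
  inv_dec.
have lower alpha gamma := @morrey_norm_kernel_le_op_norm R n n0 v v0 vE Cr Cr0
  radial
  phi g c phi_gt0 c0 mg gz g0 gmono phig p1 C2 p1_ge1 C2_gt0 hC2
  w cw cw0 mw wz w0 wmono phiw s' t t' p2 C3 s'_gt0 tt' p2_gt0 p12 C3_gt0 hC3
    alpha gamma.
set L := lower_constant _ _ _ _ _ _ _ _ * _ in lower.
have L0 : 0 < L by rewrite mulr_gt0 ?lower_constant_gt0 ?radial_norm_gt0.
have bounds alpha gamma : alpha < n%:R -> 0 <= gamma ->
    ((L^-1)%:E * @morrey_norm R n p1 t (EFin \o bessel_riesz_kernel alpha gamma)
       <= opn (bessel_riesz alpha gamma)
       <= C5%:E * @morrey_norm R n s t (EFin \o bessel_riesz_kernel alpha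
         gamma))%E.
  move=> an gamma0; apply/andP; split; last exact: upper.
  by rewrite lee_pdivrMl//; exact: lower.
exists L^-1, C5; split => //; first by rewrite invr_gt0.
- by move=> alpha gamma /andP[_ an] gamma0 _ _; exact: bounds.
- by move=> alpha /andP[_ an] _ _ _ _ _; exact: bounds.
Qed.
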